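(* Let $m\in\mathbb N$, $\mathcal A=\{1,2,\dots,m\}$, $\Omega=\mathcal A^{\mathbb Z}$, let $T:\Omega\to\Omega$ be the shift $[T\omega](n)=\omega(n+1)$, let $\mu_0$ be a probability measure on $\mathcal A$, let $\mu=\mu_0^{\mathbb Z}$ be the product measure, and write $w_j=\mu_0(\{j\})$ for $1\le j\le m$. Then $$\mathfrak A(\Omega,T,\mu)=\mathbb Z[w_1,w_2,\dots,w_m].$$ In particular, in the case of equal weighting $w_1=\cdots=w_m=1/m$, one has $\mathfrak A(\Omega,T,\mu)=\mathbb Z[1/m]$.
   Context: $\mathbb T=\mathbb R/\mathbb Z$; $\Omega$ carries the product topology. $\mathbb Z[w_1,\dots,w_m]\subseteq\mathbb R$ is the set of all values at $(w_1,\dots,w_m)$ of polynomials in $m$ variables with integer coefficients. For a compact metric space $\Omega$, homeomorphism $T:\Omega\to\Omega$ and $T$-ergodic Borel probability measure $\mu$: the suspension is $X=(\Omega\times\mathbb R)/\!\sim$, where $(\omega,t)\sim(\omega',t')$ iff $(\omega',t')=(T^n\omega,t-n)$ for some $n\in\mathbb Z$, with classes $[\omega,t]$, flow $\overline T^{t}[\omega,s]=[\omega,s+t]$, and $\overline T$-ergodic measure $\overline\mu$ given by $\int_X g\,d\overline\mu=\int_0^1\int_\Omega g[\omega,s]\,d\mu(\omega)\,ds$. $C^\sharp(X,\mathbb T)$ is the group of homotopy classes of continuous maps $X\to\mathbb T$ (pointwise addition). For $\phi\in C(X,\mathbb T)$, $x\in X$, let $\widetilde\phi_x:\mathbb R\to\mathbb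 R$ be a continuous lift of $t\mapsto\phi(\overline T^{t}x)$. For $\overline\mu$-a.e. $x$, $\lim_{t\to\infty}\widetilde\phi_x(t)/t$ exists and equals a constant depending only on $[\phi]$, denoted $\mathfrak A_{\overline\mu}([\phi])$ (the Schwartzman homomorphism). $\mathfrak A(\Omega,T,\mu)=\mathfrak A_{\overline\mu}(C^\sharp(X,\mathbb T))\subseteq\mathbb R$ is its range. *)

(* Defs.v *)
From HB Require Import structures.
From mathcomp Require Import all_boot all_order all_algebra.
From mathcomp Require Import generic_quotient finmap.
From mathcomp Require Import all_classical all_reals all_analysis.
From mathcomp Require Import measurable_realfun.
(* Not imported: its notations clash with those of mathcomp-analysis. *)
From mathcomp Require mpoly.

Set Implicit Arguments.
Unset Strict Implicit.
Unset Printing Implicit Defensive.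

Import Order.TTheory GRing.Theory Num.Theory.
Import numFieldNormedType.Exports.

Local Open Scope classical_set_scope.
Local Open Scope ring_scope.
Local Open Scope quotient_scope.

Section Circle.
Variable R : realType.

Definition mod1_rel : rel R := fun x y => x - y \is a Num.int.

Lemma mod1_refl : reflexive mod1_rel.
Proof. by move=> x; rewrite /mod1_rel subrr rpred0. Qed.

Lemma mod1_sym : symmetric mod1_rel.
Proof. by move=> x y; rewrite /mod1_rel -rpredN opprB. Qed.

Lemma mod1_trans : transitive mod1_rel.
Proof. by move=> y x z xy yz; rewrite /mod1_rel -(subrKA y) rpredD. Qed.

Definition congruent_mod1 := EquivRel mod1_rel mod1_refl mod1_sym mod1_trans.

Definition circle := {eq_quot congruent_mod1}.

HB.instance Definition _ := Topological.copy circle (quotient_topology circle).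
HB.instance Definition _ := Quotient.on circle.

Definition to_circle (x : R) : circle := \pi_circle x.

End Circle.

(* A compact metric space with a self-homeomorphism. *)
Record system (R : realType) := System {
  phase :> pseudoPMetricType R;
  phase_compact : compact [set: phase];
  phase_hausdorff : hausdorff_space phase;
  shift : phase -> phase;
  unshift : phase -> phase;
  shiftK : cancel shift unshift;
  unshiftK : cancel unshift shift;
  shift_continuous : continuous shift;
  unshift_continuous : continuous unshift }.

Section IntegerIterates.
Variables (R : realType) (S : system R).

Definition iterz (n : int) : S -> S :=
  match n with
  | Posz k => iter k (@shift R S)
  | Negz k => iter k.+1 (@unshift R S)
  end.

Lemma iterzS n w : iterz (n + 1) w = shift (iterz n w).
Proof.
case: n => [n|[|n]]; first by rewrite -PoszD addn1.
  by rewrite /= unshiftK.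
have -> : Negz n.+1 + 1 = Negz n by rewrite !NegzE -addn1 PoszD opprD addrNK.
by rewrite /= unshiftK.
Qed.

Lemma iterzB1 n w : iterz (n - 1) w = unshift (iterz n w).
Proof. by rewrite -{2}(subrK 1 n) iterzS shiftK. Qed.

Lemma iterzD n p w : iterz (n + p) w = iterz n (iterz p w).
Proof.
elim: n => [|n IH|n IH]; first by rewrite add0r.
  by rewrite -addn1 PoszD addrAC !iterzS IH.
have -> : - n.+1%:Z = - n%:Z - 1 by rewrite -addn1 PoszD opprD.
by rewrite addrAC !iterzB1 IH.
Qed.

End IntegerIterates.

Definition borel (X : ptopologicalType) : measurableType _ :=
  g_sigma_algebraType (@open X).

Section Suspension.
Variables (R : realType) (S : system R).

Definition susp_rel : rel (S * R) := fun p q =>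
  `[< exists n : int, q = (iterz n p.1, p.2 - n%:~R) >].

Lemma susp_refl : reflexive susp_rel.
Proof. by case=> w t; apply/asboolP; exists 0; rewrite /= subr0. Qed.

Lemma susp_rev p q : susp_rel p q -> susp_rel q p.
Proof.
case: p => w t /asboolP[n ->]; apply/asboolP; exists (- n) => /=.
by rewrite -iterzD addNr /= mulrNz opprK subrK.
Qed.

Lemma susp_sym : symmetric susp_rel.
Proof. by move=> p q; apply/idP/idP; apply: susp_rev. Qed.

Lemma susp_trans : transitive susp_rel.
Proof.
move=> q p r /asboolP[n ->] /asboolP[k ->]; apply/asboolP; exists (k + n) => /=.
by rewrite -iterzD intrD opprD addrA addrAC.
Qed.

Definition suspension_rel := EquivRel susp_rel susp_refl susp_sym susp_trans.

Definition suspension := {eq_quot suspension_rel}.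

HB.instance Definition _ :=
  Topological.copy suspension (quotient_topology suspension).
HB.instance Definition _ := Quotient.on suspension.
HB.instance Definition _ :=
  isPointed.Build suspension (\pi_suspension (point : S, 0 : R)).

Definition susp (w : S) (t : R) : suspension := \pi_suspension (w, t).

Definition susp_flow (t : R) (x : suspension) : suspension :=
  susp (repr x).1 ((repr x).2 + t).

Lemma susp_flowE t w s : susp_flow t (susp w s) = susp w (s + t).
Proof.
rewrite /susp_flow /susp; case: piP => -[v r] /eqmodP /asboolP[n /= [-> ->]].
by apply/eqmodP/susp_rev/asboolP; exists n; rewrite /= addrAC.
Qed.

End Suspension.

Section SuspensionMeasure.
Variables (R : realType) (S : system R).
Local Open Scope ereal_scope.

Lemma measurable_prod_open (U : set (S * R)) :
  open U -> measurable (U : set (borel S * measurableTypeR R)%type).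
Proof.
move=> oU.
have [B cB [Bo Bb]] := compact_second_countable (phase_compact (s := S)).
pose I (q : rat * rat) : set R := `]ratr q.1, ratr q.2[%classic.
pose J := [set p : set S * (rat * rat) | B p.1 /\ p.1 `*` I p.2 `<=` U].
have -> : U = \bigcup_(p in J) (p.1 `*` I p.2).
  apply/seteqP; split=> [[w t] Uwt|[w t] [p [_ pU] /pU//]].
  have [[/= V W] [nV nW] VW] : nbhs (w, t) U by exact: open_nbhs_nbhs.
  have [C [BC Cw] CV] := Bb w _ nV.
  have /nbhs_ballP[e /= e0 eW] := nW.
  have [a /andP[a1 a2]] : exists q : rat, (t - e < ratr q < t)%R.
    have /rat_in_itvoo[q /itvP qq] : (t - e < t)%R by rewrite ltrBlDr ltrDl.
    by exists q; rewrite !qq.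
  have [b /andP[b1 b2]] : exists q : rat, (t < ratr q < t + e)%R.
    have /rat_in_itvoo[q /itvP qq] : (t < t + e)%R by rewrite ltrDl.
    by exists q; rewrite !qq.
  exists (C, (a, b)); last by split=> //=; rewrite /I /= in_itv /= a2 b1.
  split=> //= -[v r] [/= Cv]; rewrite /I /= in_itv /= => /andP[ar rb].
  apply: VW; split; first exact: CV.
  apply: eW; rewrite /ball /= /ball_ /= ltr_distlC.
  by rewrite (lt_trans a1 ar) (lt_trans rb b2).
have /countable_injP[f /= finj] : countable J.
  apply: (@sub_countable _ _ _ (B `*` [set: rat * rat])).
    by apply: subset_card_le => p [].
  exact: countableX.
rewrite (_ : \bigcup_(p in J) _ =
  \bigcup_n \bigcup_(p in J `&` f @^-1` [set n]) (p.1 `*` I p.2)); last first.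
  apply/seteqP; split=> [x [p Jp px]|x [_ _ [p [Jp _] px]]]; last by exists p.
  by exists (f p) => //; exists p.
apply: bigcupT_measurable => n.
have [->|/set0P[p [Jp /= fp]]] := eqVneq (J `&` f @^-1` [set n]) set0.
  by rewrite bigcup_set0.
rewrite (_ : J `&` _ = [set p]); last first.
  apply/seteqP; split=> [q [Jq /= fq]|_ -> //].
  by apply: finj; rewrite ?inE// fp fq.
rewrite bigcup_set1; apply: measurableX; last exact: measurable_itv.
by apply: sub_sigma_algebra; apply: Bo; case: Jp.
Qed.

Lemma measurable_susp : measurable_fun setT
  ((fun p => susp p.1 p.2) :
    borel S * measurableTypeR R -> borel (suspension S)).
Proof.
apply: (@measurability _ _ (borel S * measurableTypeR R)%type
  (borel (suspension S)) _ _ (@open (suspension S))) => // _ [U oU <-].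
rewrite setTI; apply: measurable_prod_open.
have /continuousP/(_ _ oU) := @pi_continuous _ (suspension S).
by congr open; apply/seteqP; split=> -[].
Qed.

Section Measure.
Variable mu : probability (borel S) R.

(* The integral over s in [0, 1] and w in S of g [w, s], for g the indicator
   function of A. *)
Definition suspension_measure (A : set (borel (suspension S))) : \bar R :=
  \int[lebesgue_measure]_(s in `[0%R, 1%R]) mu [set w | A (susp w s)].

Let fibers (A : set (borel (suspension S))) :
  set (borel S * measurableTypeR R) :=
  (fun p => susp p.1 p.2) @^-1` A.

Let fiber_ysection (A : set (borel (suspension S))) s :
  [set w | A (susp w s)] = ysection (fibers A) s.
Proof. by apply/seteqP; split=> w; rewrite /ysection /= inE. Qed.

Let measurable_fibers (A : set (borel (suspension S))) :
  measurable A -> measurable (fibers A).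
Proof.
by move=> mA; rewrite -[fibers A]setTI; exact: measurable_susp.
Qed.

Let measurable_fiber (A : set (borel (suspension S))) (s : R) : measurable A ->
  measurable ([set w | A (susp w s)] : set (borel S)).
Proof.
move=> mA; rewrite fiber_ysection.
by apply: measurable_ysection; exact: measurable_fibers.
Qed.

Let measurable_fun_fiber (A : set (borel (suspension S))) : measurable A ->
  measurable_fun (`[0%R, 1%R] : set (measurableTypeR R))
    (fun s : R => mu [set w | A (susp w s)]).
Proof.
move=> mA; apply: (eq_measurable_fun (mu \o ysection (fibers A))).
  by move=> s _ /=; rewrite fiber_ysection.
apply: measurable_funTS.
by apply: (measurable_fun_ysection mu); exact: measurable_fibers.
Qed.

Let suspension_measure0 : suspension_measure set0 = 0.
Proof.
by rewrite /suspension_measure integral0_eq// => s _; exact: measure0.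
Qed.

Let suspension_measure_ge0 A : 0 <= suspension_measure A.
Proof. by apply: integral_ge0 => s _; exact: measure_ge0. Qed.

Let suspension_measure_sigma_additive : semi_sigma_additive suspension_measure.
Proof.
move=> F mF tF mUF.
rewrite [X in _ --> X](_ : _ = \sum_(n <oo) suspension_measure (F n)).
  by apply/cvg_closeP; split; [exact: is_cvg_nneseries|rewrite closeE].
rewrite -integral_nneseries//; last by move=> n; exact: measurable_fun_fiber.
apply: eq_integral => s _; apply/esym/cvg_lim => //=.
rewrite (_ : [set w | _] = \bigcup_n [set w | F n (susp w s)]); last first.
  by apply/seteqP; split.
apply: measure_semi_sigma_additive.
- by move=> n; exact: measurable_fiber.
- apply/trivIsetP => i j _ _ ij; rewrite -subset0 => w [/= Fi Fj].
  by move/trivIsetP: tF => /(_ i j I I ij); rewrite -subset0; apply; split;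
    [exact: Fi|].
- by apply: bigcupT_measurable => n; exact: measurable_fiber.
Qed.

HB.instance Definition _ := isMeasure.Build _ _ _ suspension_measure
  suspension_measure0 suspension_measure_ge0 suspension_measure_sigma_additive.

Let suspension_measureT : suspension_measure setT = 1.
Proof.
rewrite /suspension_measure.
under eq_integral do rewrite (probability_setT mu).
rewrite integral_cst//= mul1e.
by rewrite lebesgue_measure_itv /= lte_fin ltr01 oppr0 adde0.
Qed.

HB.instance Definition _ := Measure_isProbability.Build _ _ _
  suspension_measure suspension_measureT.

End Measure.
End SuspensionMeasure.

Section Homotopy.
Variables (R : realType) (X Y : topologicalType).

Definition homotopic (f g : X -> Y) :=
  exists H : X * R -> Y,
    [/\ {within [set: X] `*` `[0, 1], continuous H},
        forall x, H (x, 0) = f x & forall x, H (x, 1) = g x].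

Definition homotopy_class (f : X -> Y) : set (X -> Y) :=
  [set g | continuous g /\ homotopic f g].

Definition homotopy_classes : set (set (X -> Y)) :=
  [set homotopy_class f | f in [set f : X -> Y | continuous f]].

End Homotopy.

Section Schwartzman.
Variables (R : realType) (S : system R) (mu : probability (borel S) R).

Definition Csharp : set (set (suspension S -> circle R)) :=
  @homotopy_classes R (suspension S) (circle R).

Definition orbit_lift (phi : suspension S -> circle R) (x : suspension S)
    (f : R -> R) :=
  continuous f /\ forall t, to_circle (f t) = phi (susp_flow t x).

(* Two lifts along the same orbit differ by a constant, so the limit does not
   depend on the choice of f. *)
Definition has_rotation_number (phi : suspension S -> circle R) (a : R) :=
  {ae suspension_measure mu, forall x,
    exists2 f, orbit_lift phi x f & f t / t @[t --> +oo] --> a}.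

(* For mu ergodic, the maps phi in a class c have a common rotation number, and
   get selects it. *)
Definition schwartzman (c : set (suspension S -> circle R)) : R :=
  get [set a | forall phi, c phi -> has_rotation_number phi a].

Definition schwartzman_group : set R := [set schwartzman c | c in Csharp].

End Schwartzman.

(* Z[w_1, ..., w_m] *)
Definition int_poly_values (R : realType) (m : nat) (w : 'I_m -> R) : set R :=
  range (fun p : mpoly.mpoly m int => mpoly.mmap intr w p).

Section FullShift.
Variables (R : realType) (n : nat).

(* The alphabet {1, ..., n.+1}; j : 'I_n.+1 stands for the letter j.+1. *)
Definition alphabet := discrete_topology 'I_n.+1.

HB.instance Definition _ := DiscreteTopology.on alphabet.
HB.instance Definition _ := PseudoMetric.copy alphabet
  (discrete_topology 'I_n.+1 : pseudoMetricType R).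
HB.instance Definition _ := isPointed.Build alphabet (ord0 : 'I_n.+1).

Definition full_space := prod_topology (fun _ : int => alphabet).

HB.instance Definition _ := PseudoMetric.copy full_space
  (prod_topology (fun _ : int => alphabet : pseudoMetricType R)).
HB.instance Definition _ := Pointed.copy full_space
  (prod_topology (fun _ : int => alphabet : ptopologicalType)).

Lemma full_space_compact : compact [set: full_space].
Proof.
have fin : finite_set [set: alphabet] := @finite_finset 'I_n.+1 setT.
have := @tychonoff int (fun _ => alphabet) _ (fun _ => finite_compact fin).
by congr compact; apply/seteqP; split.
Qed.

Lemma full_space_hausdorff : hausdorff_space full_space.
Proof.
apply: (@hausdorff_product int (fun _ => alphabet)) => _.
exact: discrete_hausdorff.
Qed.

Definition translate (k : int) (w : full_space) : full_space :=
  fun i => w (i + k).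

Lemma translate_continuous k : continuous (translate k).
Proof.
move=> w; apply/cvg_sup => i U [V [[W oW <-]] Wi WU].
have : nbhs w ((@proj int (fun _ => alphabet) (i + k)) @^-1` W).
  by apply: proj_continuous; exact: open_nbhs_nbhs.
by apply: (@filterS _ _ (nbhs_filter w)) => v Wv; exact: WU.
Qed.

Lemma translateK k : cancel (translate k) (translate (- k)).
Proof. by move=> w; apply/funext => i; rewrite /translate subrK. Qed.

Lemma translateNK k : cancel (translate (- k)) (translate k).
Proof. by move=> w; apply/funext => i; rewrite /translate addrK. Qed.

(* The full shift, (T w)(i) = w(i + 1). *)
Definition full_shift : system R :=
  @System R full_space full_space_compact full_space_hausdorff
    (translate 1) (translate (- 1)) (translateK 1) (translateNK 1)
    (@translate_continuous 1) (@translate_continuous (- 1)).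

Definition is_product_measure (mu0 : probability (borel alphabet) R)
    (mu : probability (borel full_shift) R) :=
  forall (J : {fset int}) (A : int -> set alphabet),
    mu [set w | forall j, j \in J -> A j (w j)] =
    (\prod_(j <- J) mu0 (A j))%E.

End FullShift.

(* Main.v *)
(* Schwartzman numbers reduce to Birkhoff averages.  Since the full shift is
   zero-dimensional, a continuous circle-valued map phi on its suspension lifts
   to a continuous real map F on (full shift) x R, and the rotation number of
   phi is the Birkhoff average of F(w, 1) - F(w, 0), which is cohomologous to
   the continuous integer-valued function f(w) = F(w, 1) - F(T w, 0).  Along a
   homotopy f varies continuously, hence not at all.  A continuous
   integer-valued f is a finite integer combination of indicators of
   cylinders, whose averages are products of letter weights by the strong law
   of large numbers.  Conversely every such f is realized by the map
   [w, t] |-> t f(w), 0 <= t <= 1, and the indicators of cylinders realize all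
   monomials in the weights. *)

Require Import Defs.
From mathcomp Require Import all_boot all_order all_algebra.
From mathcomp Require Import generic_quotient finmap.
From mathcomp Require Import all_classical all_reals all_analysis.
From mathcomp Require Import measurable_realfun ring lra zify.
From mathcomp Require mpoly.

Set Implicit Arguments.
Unset Strict Implicit.
Unset Printing Implicit Defensive.

Import Order.TTheory GRing.Theory Num.Theory.
Import numFieldNormedType.Exports.

Local Open Scope classical_set_scope.
Local Open Scope ring_scope.
Local Open Scope quotient_scope.

(** The difference [F(w, 1) - F(T w, 0)] is an integer because [[w, 1] = [T w, 0]] in the
    suspension. Lifts rest on [cdiff], the shortest signed arc between two points of the circle: it
    is additive on short arcs and continuous away from antipodal pairs, so a path is lifted by
    adding short arcs. Compactness of the time interval gives one step size for all nearby
    parameters. Translates of a cylinder are independent only once their windows are disjoint, so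
    the strong law is proved for events of equal probability that are pairwise independent at
    distance at least [L]. This already makes the variance linear in the number of terms. A set
    whose fibres are all null is null for the suspension measure once it is known to be Borel. The
    good set is therefore described by increments of the lift, which are continuous on the
    suspension. Since [schwartzman] selects its value by [get], two facts are needed: a rotation
    number is unique, and all maps in a class share it. Its existence comes directly from the strong
    law, without an appeal to an ergodic theorem. *)

Section Continuity.

Lemma continuous_pair_at (T U V : topologicalType) (f : T -> U) (g : T -> V)
    (x : T) : {for x, continuous f} -> {for x, continuous g} ->
  {for x, continuous (fun t => (f t, g t))}.
Proof. by move=> cf cg; apply: (@cvg_pair _ _ _ _ (nbhs (f x)) (nbhs (g x))). Qed.

Lemma pairl_continuous (U V : topologicalType) (c : V) :
  continuous (fun t : U => (t, c)).
Proof. by move=> t; apply: continuous_pair_at; [exact: cvg_id|exact: cst_continuous]. Qed.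

Lemma pairr_continuous (U V : topologicalType) (c : U) :
  continuous (fun t : V => (c, t)).
Proof. by move=> t; apply: continuous_pair_at; [exact: cst_continuous|exact: cvg_id]. Qed.

Lemma continuous_compT (U V W : topologicalType) (f : U -> V) (g : V -> W) :
  continuous f -> continuous g -> continuous (fun t => g (f t)).
Proof. by move=> cf cg t; exact: continuous_comp (cf t) (cg (f t)). Qed.

Variable R : realType.

Lemma continuous_sum_at (T : topologicalType) (I : Type) (r : seq I)
    (f : I -> T -> R) (x : T) : (forall i, {for x, continuous (f i)}) ->
  {for x, continuous (fun t => \sum_(i <- r) f i t)}.
Proof.
move=> cf; apply: cvg_big => [|i _]; last exact: cf.
exact: add_continuous.
Qed.

Lemma continuousM_at (T : topologicalType) (f g : T -> R) (x : T) :
  {for x, continuous f} -> {for x, continuous g} ->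
  {for x, continuous (fun t => f t * g t)}.
Proof. by move=> cf cg; exact: cvgM. Qed.

Lemma continuousD_at (T : topologicalType) (f g : T -> R) (x : T) :
  {for x, continuous f} -> {for x, continuous g} ->
  {for x, continuous (fun t => f t + g t)}.
Proof. by move=> cf cg; exact: cvgD. Qed.

Lemma continuousB_at (T : topologicalType) (f g : T -> R) (x : T) :
  {for x, continuous f} -> {for x, continuous g} ->
  {for x, continuous (fun t => f t - g t)}.
Proof. by move=> cf cg; exact: cvgB. Qed.

Lemma continuousZ_at (T : topologicalType) (c : R) (f : T -> R)
    (x : T) : {for x, continuous f} -> {for x, continuous (fun t => c * f t)}.
Proof. by move=> cf; apply: cvgM => //; exact: cvg_cst. Qed.

End Continuity.

(** * Lifting circle-valued maps *)

Section CircleLifting.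
Variable R : realType.
Implicit Types (x y : R) (z : circle R).

Lemma eq_to_circle x y : to_circle x = to_circle y <-> x - y \is a Num.int.
Proof. by split=> [/eqmodP//|?]; apply/eqmodP. Qed.

Lemma int_small_eq0 x : x \is a Num.int -> `|x| < 1 -> x = 0.
Proof.
move=> /intrP[k ->]; rewrite -intr_norm ltrz1 -abszE ltz_nat ltnS leqn0.
by rewrite absz_eq0 => /eqP ->.
Qed.

(* The representative of z2 - z1 in [-1/2, 1/2[. *)
Definition cdiff z1 z2 : R :=
  let d := (repr z2 : R) - (repr z1 : R) in d - (Num.floor (d + 2^-1))%:~R.

Lemma to_circle_repr z : to_circle (repr z) = z.
Proof. exact: reprK. Qed.

Lemma cdiff_mod x z : to_circle (x + cdiff (to_circle x) z) = z.
Proof.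
rewrite -[RHS]to_circle_repr; apply/eq_to_circle; rewrite /cdiff/=.
have /eq_to_circle : to_circle x = to_circle (repr (to_circle x)).
  by rewrite to_circle_repr.
set a := repr (to_circle x); set b := repr z; set k := Num.floor _ => h.
have -> : x + (b - a - k%:~R) - b = (x - a) - k%:~R.
  by move: (k%:~R) => u; clearbody a b; ring.
by rewrite rpredB// intr_int.
Qed.

Lemma cdiff_le z1 z2 : `|cdiff z1 z2| <= 2^-1.
Proof.
rewrite /cdiff/=; set d := repr _ - _.
have /andP[h1 h2] := floor_itv (d + 2^-1).
rewrite intrD in h2; rewrite ler_norml; apply/andP; split; lra.
Qed.

(** Both sides agree modulo 1. One is at most 1/2 in absolute value and the other is strictly less,
    so the integer between them is 0. *)
Lemma cdiff_unique x y : `|y - x| < 2^-1 ->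
  cdiff (to_circle x) (to_circle y) = y - x.
Proof.
move=> yx; apply/eqP; rewrite -subr_eq0; apply/eqP/int_small_eq0.
  have /eq_to_circle := cdiff_mod x (to_circle y).
  by congr (_ \is a _); ring.
have := cdiff_le (to_circle x) (to_circle y).
by have := ler_normB (cdiff (to_circle x) (to_circle y)) (y - x); lra.
Qed.

Lemma cdiffzz z : cdiff z z = 0.
Proof.
rewrite -(to_circle_repr z) cdiff_unique ?subrr// normr0 invr_gt0//.
Qed.

(** Following both arcs from a real lift of [z1] gives a net displacement below 1/2, which
    [cdiff_unique] recognizes as the shortest arc. *)
Lemma cdiff_addE z1 z2 z3 : `|cdiff z1 z2 + cdiff z2 z3| < 2^-1 ->
  cdiff z1 z3 = cdiff z1 z2 + cdiff z2 z3.
Proof.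
move=> h; set x := repr z1.
have e1 : to_circle x = z1 by exact: to_circle_repr.
have e2 : to_circle (x + cdiff z1 z2) = z2 by rewrite -e1 cdiff_mod.
have e3 : to_circle (x + cdiff z1 z2 + cdiff z2 z3) = z3.
  by rewrite -{2}e2 cdiff_mod.
have e : x + cdiff z1 z2 + cdiff z2 z3 - x = cdiff z1 z2 + cdiff z2 z3 by ring.
by rewrite -{1}e1 -{1}e3 cdiff_unique e.
Qed.

(** Strictness matters: between antipodal points the arc is -1/2 in both directions. *)
Lemma cdiffC z1 z2 : `|cdiff z1 z2| < 2^-1 -> cdiff z2 z1 = - cdiff z1 z2.
Proof.
move=> h; set x := repr z1.
have e1 : to_circle x = z1 by exact: to_circle_repr.
have e2 : to_circle (x + cdiff z1 z2) = z2 by rewrite -e1 cdiff_mod.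
have e : x - (x + cdiff z1 z2) = - cdiff z1 z2 by ring.
by rewrite -{1}e1 -{1}e2 cdiff_unique e ?normrN.
Qed.

Lemma cdiff_triangle z1 z2 z3 : `|cdiff z1 z2| < 4^-1 ->
  `|cdiff z2 z3| < 4^-1 -> `|cdiff z1 z3| < 2^-1.
Proof.
move=> h1 h2.
have h : `|cdiff z1 z2 + cdiff z2 z3| < 2^-1.
  by apply: le_lt_trans (ler_normD _ _) _; lra.
by rewrite (cdiff_addE h).
Qed.

Lemma to_circle_continuous : continuous (@to_circle R).
Proof. exact: pi_continuous. Qed.

Lemma near_cdiff z (e : R) : 0 < e -> \forall z' \near z, `|cdiff z z'| < e.
Proof.
move=> e0; set a := repr z.
pose d := Num.min e 2^-1.
have d0 : 0 < d by rewrite lt_min e0 invr_gt0/=.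
pose V := [set z' : circle R | exists2 b, to_circle b = z' & `|b - a| < d].
have oV : open V.
  (* Openness in the quotient is openness of the preimage in the line, here a union of integer
     translates of a ball. *)
  rewrite /open/= /quotient_open/=.
  rewrite (_ : _ @^-1` V =
    \bigcup_(k in [set: int]) ball (a + k%:~R) d); last first.
    apply/seteqP; split=> [x [b /esym/eq_to_circle/intrP[k xb] ba]|x [k _ xk]].
      exists k => //; rewrite /ball/= distrC.
      by rewrite (_ : x - _ = b - a)//; lra.
    exists (x - k%:~R).
      by apply/eq_to_circle; rewrite addrAC subrr sub0r rpredN intr_int.
    by move: xk; rewrite /ball/= distrC opprD addrA addrAC.
  by apply: bigcup_open => k _; exact: ball_open.
have Vz : V z by exists a; rewrite ?to_circle_repr// subrr normr0.
apply: (filterS _ (open_nbhs_nbhs (conj oV Vz))) => z' [b <- ba].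
move: ba; rewrite lt_min => /andP[be b2].
by rewrite -(to_circle_repr z) -/a cdiff_unique.
Qed.

Lemma cdiff_continuous (P : topologicalType) (f g : P -> circle R) (p : P) :
  {for p, continuous f} -> {for p, continuous g} ->
  `|cdiff (f p) (g p)| < 2^-1 ->
  {for p, continuous (fun q => cdiff (f q) (g q))}.
Proof.
move=> cf cg h; apply/cvgrPdist_lt => e e0.
(* The two endpoint displacements total less than [2 * d]: the first bound turns this into the error
   [e], the second keeps every intermediate arc below 1/2 so that arcs add. *)
pose d := Num.min (e / 2) ((2^-1 - `|cdiff (f p) (g p)|) / 2).
have d0 : 0 < d by rewrite lt_min divr_gt0//=; lra.
have [de dh] : d <= e / 2 /\ d <= (2^-1 - `|cdiff (f p) (g p)|) / 2.
  by split; rewrite /d ge_min lexx ?orbT.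
have := normr_ge0 (cdiff (f p) (g p)) => h0.
have nf := cf _ (near_cdiff (f p) d0).
have ng := cg _ (near_cdiff (g p) d0).
near=> q.
have fq : `|cdiff (f p) (f q)| < d by near: q.
have gq : `|cdiff (g p) (g q)| < d by near: q.
have fq' : `|cdiff (f p) (f q)| < 2^-1 by lra.
have e1 : cdiff (f p) (g q) = cdiff (f p) (g p) + cdiff (g p) (g q).
  by apply: cdiff_addE; apply: le_lt_trans (ler_normD _ _) _; lra.
have e2 : cdiff (f q) (g q) = cdiff (f q) (f p) + cdiff (f p) (g q).
  apply: cdiff_addE; rewrite e1 (cdiffC fq').
  apply: le_lt_trans (ler_normD _ _) _; rewrite normrN.
  by have := ler_normD (cdiff (f p) (g p)) (cdiff (g p) (g q)); lra.
rewrite e2 e1 (cdiffC fq').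
have E (a b c : R) : a - (- b + (a + c)) = b - c by ring.
rewrite E.
by apply: le_lt_trans (ler_normB _ _) _; lra.
Unshelve. all: by end_near.
Qed.

(** Distinct integer values at the ends would force, by the intermediate value theorem, the value
    1/2 above the smaller one. *)
Lemma continuous_int_eq (d : R -> R) :
  (forall r, 0 <= r <= 1 -> {for r, continuous d}) ->
  (forall r, 0 <= r <= 1 -> d r \is a Num.int) -> d 0 = d 1.
Proof.
move=> cd id; apply/eqP/negPn/negP => d01.
have cw : {within `[0%R, 1%R], continuous d}.
  by apply: continuous_in_subspaceT => x; rewrite inE/= in_itv/= => /cd.
have i0 : d 0 \is a Num.int by apply: id; rewrite lexx ler01.
have i1 : d 1 \is a Num.int by apply: id; rewrite lexx ler01.
pose v := (d 0 + d 1) / 2.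
pose k := Num.floor (Num.min (d 0) (d 1)).
have hmin : k%:~R = Num.min (d 0) (d 1).
  by apply/eqP; rewrite -intrEfloor /Num.min; case: ifP.
have hmax : k%:~R + 1 <= Num.max (d 0) (d 1).
  move: i0 i1 d01 hmin => /intrP[a ->] /intrP[b ->].
  rewrite eqr_int -intrD1 /Num.min /Num.max !ltr_int.
  case: ltP => ab ne /eqP; rewrite eqr_int => /eqP ->; rewrite ler_int lezD1//.
  by rewrite lt_neqAle eq_sym ne.
have vin : Num.min (d 0) (d 1) <= k%:~R + 2^-1 <= Num.max (d 0) (d 1).
  by rewrite -hmin; apply/andP; split; lra.
have [c] := IVT (@ler01 R) cw vin; rewrite in_itv/= => /id ic dc.
have : 2^-1 \is a @Num.int R.
  have -> : 2^-1 = d c - k%:~R by rewrite dc; ring.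
  by rewrite rpredB// intr_int.
move=> /int_small_eq0 h.
have /eqP : 2^-1 = 0 :> R by apply: h; rewrite ger0_norm; lra.
by rewrite invr_eq0 pnatr_eq0.
Qed.

End CircleLifting.

(** * Lifting along a time interval and along the line, with a parameter *)

Section Lifting.
Variable R : realType.

(** Steps of this length never reach an antipode, which is where [cdiff] loses continuity. *)
Definition fine_steps (P : Type) (th : P * R -> circle R) (p : P) (N : nat) :=
  forall (x y : R), 0 <= x <= 1 -> `|y - x| <= N.+1%:R^-1 ->
  `|cdiff (th (p, x)) (th (p, y))| < 2^-1.

(* Endpoint at time r of the lift, starting at h p, of the path th (p, _): the
   displacements along N + 1 equal steps are summed. *)
Definition step_lift (P : Type) (th : P * R -> circle R) (h : P -> R) (N : nat)
    (p : P) (r : R) : R :=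
  h p + \sum_(i < N.+1) cdiff (th (p, r * (i%:R / N.+1%:R)))
                              (th (p, r * (i.+1%:R / N.+1%:R))).

Section Fixed.
Variables (P : topologicalType) (th : P * R -> circle R) (h : P -> R).
Hypothesis cth : continuous th.

(** Uniform continuity in time, locally uniform in the parameter: around each time [th] stays within
    a quarter turn on a product neighbourhood, and compactness of [[0, 1]] extracts one step size
    and one neighbourhood of [p]. *)
Lemma near_fine_steps (p : P) :
  exists N, \forall q \near p, fine_steps th q N.
Proof.
have cI : compact `[0%R, 1%R : R] by exact: segment_compact.
have /compact_near_coveringP nI := cI.
pose Q (i : P * nat) (x : R) := forall y, `|y - x| <= i.2.+1%:R^-1 ->
  `|cdiff (th (i.1, x)) (th (i.1, y))| < 2^-1.
have : filter_prod (nbhs p) \oo (fun i => `[0%R, 1%R : R] `<=` Q i).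
  apply: (nI (P * nat)%type (filter_prod (nbhs p) \oo) Q) => x _.
  have q0 : 0 < 4^-1 :> R by rewrite invr_gt0.
  have [[V W] [/= nV /nbhs_ballP[e /= e0 eW]] VW] := cth (near_cdiff (th (p, x)) q0).
  have close z u : V z -> `|u - x| < e -> `|cdiff (th (p, x)) (th (z, u))| < 4^-1.
    move=> Vz ux; apply: (VW (z, u)); split => //=.
    by apply: eW; rewrite /ball/= distrC.
  have e20 : 0 < e / 2 by rewrite divr_gt0.
  (* Half of the radius is spent on reaching [x'], the other half on the step from [x'] to [y]. *)
  exists (ball x (e / 2), [set i | V i.1 /\ i.2.+1%:R^-1 < e / 2]) => /=.
    split; first exact: nbhsx_ballx.
    exists (V, [set N : nat | N.+1%:R^-1 < e / 2]).
      by split => //=; exact: (near_infty_natSinv_lt (PosNum e20)).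
    by case.
  move=> [x' [z N]] /= [xx' [Vz Ne]] y yx'.
  move: xx'; rewrite /ball/= distrC => xx'.
  have h1 : `|cdiff (th (p, x)) (th (z, x'))| < 4^-1.
    by apply: close => //; apply: lt_trans xx' _; lra.
  have h2 : `|cdiff (th (p, x)) (th (z, y))| < 4^-1.
    apply: close => //; rewrite (_ : y - x = (y - x') + (x' - x)); last by ring.
    by apply: le_lt_trans (ler_normD _ _) _; rewrite [e]splitr ltrD// (le_lt_trans yx').
  apply: (@cdiff_triangle _ _ (th (p, x))) => //.
  by rewrite cdiffC ?normrN//; lra.
move=> [[A B] /= [nA [N0 _ BN]] AB]; exists N0.
apply: filterS nA => q Aq x y x01 yx.
have := AB (q, N0) (conj Aq (BN N0 (leqnn _))) x.
by apply => //=; rewrite in_itv.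
Qed.

Lemma fine_steps_incr p N (i : nat) r :
  fine_steps th p N -> (i < N.+1)%N -> 0 <= r <= 1 ->
  `|cdiff (th (p, r * (i%:R / N.+1%:R))) (th (p, r * (i.+1%:R / N.+1%:R)))| < 2^-1.
Proof.
move=> fN iN /andP[r0 r1].
have N0 : 0 < N.+1%:R :> R by rewrite ltr0n.
have i1 : i%:R / N.+1%:R <= 1 :> R.
  by rewrite ler_pdivrMr// mul1r ler_nat ltnW.
have i0 : 0 <= i%:R / N.+1%:R :> R by rewrite divr_ge0.
apply: fN; first by rewrite mulr_ge0//= mulr_ile1.
rewrite -mulrBr -mulrBl -natrB// subSnn mul1r ger0_norm ?mulr_ge0 ?invr_ge0//.
by rewrite ler_piMl// invr_ge0.
Qed.

Hypothesis hh : forall p, to_circle (h p) = th (p, 0).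

Lemma step_liftK N p r : to_circle (step_lift th h N p r) = th (p, r).
Proof.
have st k : to_circle (h p + \sum_(i < k) cdiff (th (p, r * (i%:R / N.+1%:R)))
    (th (p, r * (i.+1%:R / N.+1%:R)))) = th (p, r * (k%:R / N.+1%:R)).
  elim: k => [|k IH]; first by rewrite big_ord0 addr0 mul0r mulr0.
  by rewrite big_ord_recr/= addrA -IH cdiff_mod.
by rewrite /step_lift st divff ?pnatr_eq0// mulr1.
Qed.

Lemma step_lift_continuous_time N p (r : R) : fine_steps th p N -> 0 <= r <= 1 ->
  {for r, continuous (step_lift th h N p)}.
Proof.
move=> fN r01; rewrite /step_lift.
apply: cvgD; first exact: cvg_cst.
apply: continuous_sum_at => i.
have cp (c : R) : {for r, continuous (fun r : R => th (p, r * c))}.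
  apply: (@continuous_comp _ _ _ (fun r : R => (p, r * c)) th); last exact: cth.
  apply: continuous_pair_at; first exact: cvg_cst.
  by apply: continuousM_at; [exact: cvg_id|exact: cvg_cst].
by apply: cdiff_continuous => //; exact: fine_steps_incr.
Qed.

(** The partition scales with the time [r], so both lifts are continuous in [r]. They start at [h p]
    and project to the same path, hence differ by a continuous integer-valued function vanishing at
    0. *)
Lemma step_lift_unique N M p : fine_steps th p N -> fine_steps th p M ->
  step_lift th h N p 1 = step_lift th h M p 1.
Proof.
move=> fN fM; pose d r := step_lift th h N p r - step_lift th h M p r.
have /continuous_int_eq : forall r, 0 <= r <= 1 -> {for r, continuous d}.
  by move=> r r01; apply: cvgB; exact: step_lift_continuous_time.
have st0 K : step_lift th h K p 0 = h p.
  rewrite /step_lift big1 ?addr0// => i _.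
  by rewrite !mul0r cdiffzz.
have d0 : d 0 = 0 by rewrite /d !st0 subrr.
move=> d01; apply/eqP; rewrite -subr_eq0 -[X in X == _]/(d 1) -d01 ?d0// => r _.
by apply/eq_to_circle; rewrite !step_liftK.
Qed.

Hypothesis ch : continuous h.

(** The step number is chosen point by point, with no continuity. Near a given [p] one number [M] is
    fine enough for all neighbours, and [step_lift_unique] lets it replace their own choices. *)
Lemma lift_endpoint : exists2 F : P -> R, continuous F &
  forall p, to_circle (F p) = th (p, 1).
Proof.
have ex p : exists N, fine_steps th p N.
  by have [N /nbhs_singleton] := near_fine_steps p; exists N.
pose N p := projT1 (cid (ex p)).
have fN p : fine_steps th p (N p) by exact: projT2 (cid (ex p)).
exists (fun p => step_lift th h (N p) p 1); last by move=> p; exact: step_liftK.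
move=> p; have [M nM] := near_fine_steps p.
have fM := nbhs_singleton nM.
have E : {near p, (fun q => step_lift th h M q 1) =1 (fun p => step_lift th h (N p) p 1)}.
  by apply: filterS nM => q fq; exact: step_lift_unique.
rewrite /continuous_at -(step_lift_unique fM (fN p)).
apply: cvg_trans (near_eq_cvg E) _.
apply: cvgD; first exact: ch.
apply: continuous_sum_at => i.
have cp (c : R) : {for p, continuous (fun q : P => th (q, c))}.
  apply: (@continuous_comp _ _ _ (fun q : P => (q, c)) th); last exact: cth.
  by apply: continuous_pair_at; [exact: cvg_id|exact: cvg_cst].
apply: cdiff_continuous => //.
by apply: fine_steps_incr; rewrite ?ler01 ?lexx.
Qed.

End Fixed.

Lemma lift_line (P : topologicalType) (th : P * R -> circle R) (h : P -> R) :
  continuous th -> continuous h -> (forall p, to_circle (h p) = th (p, 0)) ->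
  exists2 F : P * R -> R, continuous F & forall q, to_circle (F q) = th q.
Proof.
move=> cth ch hh.
(* The pair [(p, t)] becomes the parameter, and the path runs from [(p, 0)] to [(p, t)] in unit
   time; this covers either sign of [t]. *)
pose th' (q : (P * R) * R) := th (q.1.1, q.2 * q.1.2).
have cth' : continuous th'.
  move=> q; apply: (@continuous_comp _ _ _
    (fun q : (P * R) * R => (q.1.1, q.2 * q.1.2)) th).
    apply: continuous_pair_at.
      by apply: continuous_comp; exact: cvg_fst.
    apply: continuousM_at; first exact: cvg_snd.
    by apply: continuous_comp; [exact: cvg_fst|exact: cvg_snd].
  exact: cth.
have [||F cF FE] := @lift_endpoint _ th' (h \o fst) cth'.
- by move=> [p t]; rewrite /th'/= mul0r hh.
- by move=> q; apply: cvg_comp; [exact: cvg_fst|exact: ch].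
by exists F => // -[p t]; rewrite FE /th'/= mul1r.
Qed.

End Lifting.

(** * Continuous maps on the full shift *)

Section Windows.
Variables (R : realType) (n : nat).
Local Notation Omega := (full_shift R n).
Implicit Types (u v w : Omega).

Definition agree (N : nat) u v := forall i : int, `|i| <= N%:Z -> u i = v i.

Lemma agree_le N M u v : (N <= M)%N -> agree M u v -> agree N u v.
Proof.
by move=> NM uv i iN; apply: uv; rewrite (le_trans iN)// lez_nat.
Qed.

Lemma agree_trans N u v w : agree N u v -> agree N v w -> agree N u w.
Proof. by move=> uv vw i iN; rewrite uv// vw. Qed.

Lemma near_coord w (i : int) : \forall v \near w, v i = w i.
Proof.
have : nbhs w ((@proj int (fun _ => alphabet n) i) @^-1` [set w i]).
  apply: proj_continuous; apply: open_nbhs_nbhs; split => //.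
  exact: discrete_open.
by apply: filterS.
Qed.

Lemma near_agree N w : \forall v \near w, agree N w v.
Proof.
elim: N => [|N IH].
  apply: filterS (near_coord w 0) => v e i.
  by rewrite normr_le0 => /eqP ->.
near=> v => i; rewrite le_eqVlt => /orP[|]; last first.
  by rewrite -addn1 PoszD ltzD1; apply: (near IH v).
rewrite eqr_norml => /andP[/orP[]/eqP -> _]; apply/esym; near: v; exact: near_coord.
Unshelve. all: by end_near. Qed.

(** The filter generated by the windows around [w] converges to [w] in each coordinate, hence in the
    product topology. *)
Lemma nbhs_agree w (A : set Omega) : nbhs w A ->
  exists N, forall v, agree N w v -> A v.
Proof.
pose F := filter_from [set: nat] (fun N => [set v | agree N w v]).
have FF : Filter F.
  apply: filter_from_filter; first by exists 0%N.
  move=> i j _ _; exists (maxn i j) => // v a.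
  by split; apply: agree_le a; rewrite ?leq_maxl ?leq_maxr.
have : F --> w.
  apply/cvg_sup => i U [V [[W oW <-]] Wi WU].
  exists `|i|%N => // v a; apply: WU; rewrite /= /proj/= -a//.
by move=> /[apply] -[N _ NA]; exists N.
Qed.

(** A Lebesgue number for an open cover. Agreement on a window is transitive, as in an ultrametric
    space, so no radius has to be halved. *)
Lemma uniform_window (A : Omega -> set Omega) :
  (forall w, nbhs w (A w)) ->
  exists N, forall v, exists w, forall u, agree N v u -> A w u.
Proof.
move=> nA; pose Q (N : nat) v := exists w, forall u, agree N v u -> A w u.
have /compact_near_coveringP nc := phase_compact (s := Omega).
have [|N0 _ NQ] := nc nat \oo Q _.
  move=> w _; have [N NA] := nbhs_agree (nA w).
  exists ([set v | agree N w v], [set M | (N <= M)%N]) => /=.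
    by split; [exact: near_agree|exists N].
  move=> [v M] /= [wv NM]; exists w => u vu; apply: NA.
  exact: agree_trans wv (agree_le NM vu).
by exists N0 => v; exact: (NQ N0 (leqnn _) v I).
Qed.

Lemma int_valued_window (f : Omega -> R) : continuous f ->
  (forall w, f w \is a Num.int) ->
  exists N, forall u v, agree N u v -> f u = f v.
Proof.
move=> cf If.
have [|N NA] := @uniform_window (fun w => [set u | `|f w - f u| < 2^-1]).
  move=> w; have /cvgrPdist_lt/(_ 2^-1) := cf w.
  by apply; rewrite invr_gt0.
exists N => u v uv; apply/eqP; rewrite -subr_eq0; apply/eqP/int_small_eq0.
  by rewrite rpredB.
have [w wA] := NA u.
have h1 : `|f w - f u| < 2^-1 by exact: wA.
have h2 : `|f w - f v| < 2^-1 by exact: wA.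
rewrite (_ : f u - f v = (f w - f v) - (f w - f u)); last by ring.
by apply: le_lt_trans (ler_normB _ _) _; lra.
Qed.

(** A locally constant choice of one point per window; composing with it makes even the
    discontinuous section [repr] continuous. *)
Definition truncate N w : Omega := fun i => if `|i| <= N%:Z then w i else point.

Lemma truncate_agree N w : agree N (truncate N w) w.
Proof. by move=> i iN; rewrite /truncate iN. Qed.

Lemma near_truncate N w : \forall v \near w, truncate N v = truncate N w.
Proof.
apply: filterS (near_agree N w) => v wv; apply/funext => i.
by rewrite /truncate; case: ifP => // /wv.
Qed.

Lemma truncate_continuous N : continuous (truncate N).
Proof.
move=> w A /= nA; apply: filterS (near_truncate N w) => v e.
rewrite /preimage/= e; exact: nbhs_singleton nA.
Qed.

(* The full shift is zero-dimensional, so circle-valued maps lift: locally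
   constant choices of lifts are corrected by a small displacement. *)
Lemma full_space_lift (th : Omega -> circle R) : continuous th ->
  exists2 h : Omega -> R, continuous h & forall w, to_circle (h w) = th w.
Proof.
move=> cth.
have [|N NA] := @uniform_window (fun w => [set u | `|cdiff (th w) (th u)| < 4^-1]).
  move=> w; have q0 : 0 < 4^-1 :> R by rewrite invr_gt0.
  exact: cth (near_cdiff (th w) q0).
have small u v : agree N u v -> `|cdiff (th u) (th v)| < 2^-1.
  move=> uv; have [w wA] := NA u.
  have h1 : `|cdiff (th w) (th u)| < 4^-1 by exact: wA.
  apply: (@cdiff_triangle _ _ (th w)); last exact: wA.
  by rewrite cdiffC ?normrN//; lra.
exists (fun w => repr (th (truncate N w)) +
                 cdiff (th (truncate N w)) (th w)); last first.
  by move=> w; rewrite -{2}(to_circle_repr (th (truncate N w))) cdiff_mod.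
move=> w; apply: (@continuousD_at R Omega).
  move=> A /= nA; apply: filterS (near_truncate N w) => v e.
  by rewrite /preimage/= e; exact: nbhs_singleton nA.
apply: (@cdiff_continuous _ _ (th \o truncate N) th).
- by apply: continuous_comp; [exact: truncate_continuous|exact: cth].
- exact: cth.
- by apply: small; exact: truncate_agree.
Qed.

End Windows.

(** * A strong law for finitely dependent events *)

Section LawOfLargeNumbers.
Variable R : realType.

Lemma sqrt_bracket (n : nat) : (0 < n)%N ->
  exists k, (k.+1 * k.+1 <= n)%N /\ (n < k.+2 * k.+2)%N.
Proof.
elim: n => // -[_ _|n /(_ isT)[k [kn nk]] _]; first by exists 0%N.
have [h|h] := ltnP n.+2 (k.+2 * k.+2); first by exists k; split => //; lia.
by exists k.+1; split => //; nia.
Qed.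

(** Beyond the last square [k.+1 * k.+1] below [n] there are at most [2 * k.+1] terms, each bounded
    by 1. *)
Lemma cvg_mean_squares (b : nat -> R) : (forall k, `|b k| <= 1) ->
  (forall e : R, 0 < e -> exists K, forall k, (K <= k)%N ->
     `|\sum_(i < k.+1 * k.+1) b i| < e * (k.+1 * k.+1)%:R) ->
  (\sum_(i < n) b i) / n%:R @[n --> \oo] --> (0 : R).
Proof.
move=> b1 bs; apply/cvgrPdist_lt => e e0.
have e20 : 0 < e / 2 by rewrite divr_gt0.
have [K bK] := bs _ e20.
(* Chosen so that [4 < e * k.+1]; the gap [2 * k.+1] is then below [e / 2] times the square. *)
pose M := (Num.truncn (4 / e)).+1.
have M4 : 4 / e < M%:R by rewrite /M; apply: truncnS_gt.
exists ((K + M).+2 * (K + M).+2)%N => // n /= Mn.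
have n0 : (0 < n)%N by lia.
have [k [kn nk]] := sqrt_bracket n0.
have kKM : (K + M < k.+1)%N by nia.
have nR : 0 < n%:R :> R by rewrite ltr0n.
rewrite sub0r normrN normrM normfV (ger0_norm (ltW nR)) ltr_pdivrMr//.
pose N := (k.+1 * k.+1)%N.
have -> : \sum_(i < n) b i = \sum_(i < N) b i + \sum_(N <= i < n) b i.
  by rewrite -!(big_mkord predT b) -big_cat_nat.
apply: le_lt_trans (ler_normD _ _) _.
have h1 : `|\sum_(i < N) b i| < e / 2 * N%:R by apply: bK; lia.
have h2 : `|\sum_(N <= i < n) b i| <= (n - N)%:R.
  apply: le_trans (ler_norm_sum _ _ _) _.
  apply: (@le_trans _ _ (\sum_(N <= i < n) 1)); first by apply: ler_sum.
  by rewrite sumr_const_nat.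
have h3 : (n - N)%:R <= (2 * k.+1)%:R :> R.
  by rewrite ler_nat /N; lia.
have h4 : N%:R <= n%:R :> R by rewrite ler_nat.
have h5 : 4 < e * k.+1%:R.
  rewrite mulrC -ltr_pdivrMr//; apply: lt_le_trans M4 _.
  by rewrite ler_nat; lia.
have h6 : N%:R = k.+1%:R * k.+1%:R :> R by rewrite natrM.
have h7 : (2 * k.+1)%:R = 2 * k.+1%:R :> R by rewrite natrM.
have k0 : 0 < k.+1%:R :> R by rewrite ltr0n.
have h8 : 2 * k.+1%:R < e / 2 * N%:R.
  by rewrite h6 mulrA ltr_pM2r//; lra.
have h9 : e / 2 * N%:R <= e / 2 * n%:R by rewrite ler_pM2l.
lra.
Qed.

Context d (T : measurableType d) (P : probability T R).
Variables (A : nat -> set T) (p : R) (L : nat).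
Hypothesis mA : forall k, measurable (A k).
Hypothesis PA : forall k, P (A k) = p%:E.
Hypothesis PAI : forall j k, (j + L <= k)%N -> P (A j `&` A k) = (p ^+ 2)%:E.

Let p01 : 0 <= p <= 1.
Proof. by rewrite -!lee_fin -(PA 0%N) measure_ge0 probability_le1. Qed.

Definition visits (n : nat) (x : T) : R := \sum_(k < n) \1_(A k) x.

Lemma measurable_visits n : measurable_fun setT (visits n).
Proof. by apply: measurable_sum => k; exact: measurable_indic. Qed.

Lemma visits_ge0 n x : 0 <= visits n x.
Proof. by apply: sumr_ge0 => k _; rewrite indicE. Qed.

Lemma integral_visits n : (\int[P]_x (visits n x)%:E = (n%:R * p)%:E)%E.
Proof.
under eq_integral do rewrite /visits -sumEFin.
rewrite ge0_integral_sum//; last first.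
  by move=> k; apply/measurable_EFinP; exact: measurable_indic.
transitivity (\sum_(k < n) p%:E)%E.
  by apply: eq_bigr => k _; rewrite integral_indic// setIT; exact: PA.
by rewrite sumEFin sumr_const card_ord mulr_natl.
Qed.

Lemma visits_sqr n x :
  visits n x ^+ 2 = \sum_(j < n) \sum_(k < n) \1_(A j `&` A k) x.
Proof.
rewrite expr2 /visits mulr_suml; apply: eq_bigr => j _.
by rewrite mulr_sumr; apply: eq_bigr => k _; rewrite indicI.
Qed.

(** The indices at distance less than [L] from [j] lie in a block of [2 * L] consecutive naturals;
    truncating its start at 0 loses none of them. *)
Lemma count_close n j :
  (\sum_(k < n) ((j < k + L) && (k < j + L)) <= 2 * L)%N.
Proof.
rewrite -(big_mkord predT (fun k => nat_of_bool ((j < k + L) && (k < j + L))%N)).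
rewrite -big_mkcond/= sum1_count -size_filter.
rewrite -[leqRHS](size_iota (j.+1 - L)).
apply: uniq_leq_size; first by rewrite filter_uniq// iota_uniq.
by move=> k; rewrite mem_filter !mem_iota => /andP[/andP[? ?] _]; lia.
Qed.

(** In the expanded square a pair at distance at least [L] contributes exactly [p ^+ 2], any other
    pair at most 1, and each [j] has at most [2 * L] close partners. *)
Lemma integral_visits_sqr n :
  (\int[P]_x (visits n x ^+ 2)%:E <= (n%:R ^+ 2 * p ^+ 2 + (2 * L * n)%:R)%:E)%E.
Proof.
under eq_integral do rewrite visits_sqr -sumEFin.
rewrite ge0_integral_sum//; last 2 first.
- move=> j; apply/measurable_EFinP; apply: measurable_sum => k.
  by apply: measurable_indic; exact: measurableI.
- by move=> j x _; rewrite lee_fin sumr_ge0// => k _; rewrite indicE.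
have Pjk (j k : nat) : (P (A j `&` A k) <=
    (p ^+ 2 + ((j < k + L)%N && (k < j + L)%N)%:R)%:E)%E.
  have [jk|jk] := leqP (j + L) k.
    by rewrite PAI// lee_fin lerDl.
  have [kj|kj] := leqP (k + L) j; first by rewrite setIC PAI// lee_fin lerDl.
  apply: (le_trans (probability_le1 P (measurableI _ _ (mA j) (mA k)))).
  by rewrite lee_fin andbT/= lerDr sqr_ge0.
apply: (@le_trans _ _ (\sum_(j < n) (n%:R * p ^+ 2 + (2 * L)%:R)%:E)%E); last first.
  rewrite sumEFin lee_fin big_split/= !sumr_const card_ord.
  rewrite -(mulr_natl (n%:R * p ^+ 2)) -(mulr_natl (2 * L)%:R).
  by rewrite (natrM _ (2 * L)%N n) le_eqVlt; apply/orP; left; apply/eqP; ring.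
apply: lee_sum => j _.
under eq_integral do rewrite -sumEFin.
rewrite ge0_integral_sum//; last first.
  move=> k; apply/measurable_EFinP.
  by apply: measurable_indic; exact: measurableI.
apply: (@le_trans _ _ (\sum_(k < n)
    (p ^+ 2 + ((j < k + L)%N && (k < j + L)%N)%:R)%:E)%E).
  apply: lee_sum => k _; rewrite integral_indic ?setIT//; last exact: measurableI.
  exact: Pjk.
rewrite sumEFin lee_fin big_split/= sumr_const card_ord -(mulr_natl (p ^+ 2)) lerD2l.
by rewrite -natr_sum ler_nat count_close.
Qed.

Definition deviation (n : nat) (x : T) : R := visits n x - n%:R * p.

Lemma measurable_deviation n : measurable_fun setT (deviation n).
Proof.
by apply: measurable_funB; [exact: measurable_visits|exact: measurable_cst].
Qed.

Lemma integral_deviation_sqr n :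
  (\int[P]_x (deviation n x ^+ 2)%:E <= (2 * L * n)%:R%:E)%E.
Proof.
have [p0 p1] := andP p01.
have c0 : 0 <= 2 * (n%:R * p) by rewrite !mulr_ge0.
have md : measurable_fun setT (fun x => (deviation n x ^+ 2)%:E).
  by apply/measurable_EFinP/measurable_funX; exact: measurable_deviation.
have mv : measurable_fun setT (fun x => (visits n x)%:E).
  by apply/measurable_EFinP; exact: measurable_visits.
have ms : measurable_fun setT (fun x => (visits n x ^+ 2)%:E).
  by apply/measurable_EFinP/measurable_funX; exact: measurable_visits.
have s0 x : [set: T] x -> (0 <= (visits n x ^+ 2)%:E)%E.
  by move=> _; rewrite lee_fin sqr_ge0.
have d0 x : [set: T] x -> (0 <= (deviation n x ^+ 2)%:E)%E.
  by move=> _; rewrite lee_fin sqr_ge0.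
have q0 x : [set: T] x -> (0 <= cst ((n%:R * p) ^+ 2)%:E x)%E.
  by move=> _; rewrite lee_fin sqr_ge0.
have m0 x : [set: T] x -> (0 <= (2 * (n%:R * p))%:E * (visits n x)%:E)%E.
  by move=> _; rewrite mule_ge0// lee_fin// visits_ge0.
have mm : measurable_fun setT (fun x => ((2 * (n%:R * p))%:E * (visits n x)%:E)%E).
  exact: measurable_funeM.
have v0 x : [set: T] x -> (0 <= (visits n x)%:E)%E.
  by move=> _; rewrite lee_fin visits_ge0.
(* The expanded square is arranged with nonnegative terms on both sides, so that only additivity for
   nonnegative integrands is used. *)
have E : (\int[P]_x (deviation n x ^+ 2)%:E + (2 * (n%:R * p) * (n%:R * p))%:E =
  \int[P]_x (visits n x ^+ 2)%:E + ((n%:R * p) ^+ 2)%:E)%E.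
  have -> : ((n%:R * p) ^+ 2)%:E = (\int[P]_x (cst ((n%:R * p) ^+ 2)%:E x))%E.
    by rewrite integral_cst// -[LHS]mule1; congr mule; exact/esym/probability_setT.
  rewrite -ge0_integralD//.
  rewrite EFinM -integral_visits -ge0_integralZl ?lee_fin//.
  rewrite -ge0_integralD//.
  apply: eq_integral => x _; rewrite -EFinM -!EFinD; congr EFin.
  by rewrite /deviation; ring.
have fin2 : (2 * (n%:R * p) * (n%:R * p))%:E \is a fin_num by [].
rewrite -(leeD2rE _ _ fin2) E.
apply: le_trans (leeD2r _ (integral_visits_sqr n)) _.
by rewrite -!EFinD lee_fin le_eqVlt; apply/orP; left; apply/eqP; ring.
Qed.

Lemma deviation_event_measurable (c : R) n :
  measurable [set x | c <= `|deviation n x|].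
Proof.
rewrite (_ : [set x | _] = (fun x => `|deviation n x|) @^-1` `[c, +oo[); last first.
  by apply/seteqP; split=> x; rewrite /= in_itv/= andbT.
have mabs : measurable_fun setT (fun x => `|deviation n x|).
  by apply: measurableT_comp => //; exact: measurable_deviation.
by rewrite -[_ @^-1` _]setTI; exact: mabs.
Qed.

Lemma deviation_markov (e : R) n : 0 < e -> (0 < n)%N ->
  (P [set x | (e * n%:R <= `|deviation n x|)%R] <= ((2 * L)%:R / e ^+ 2 / n%:R)%:E)%E.
Proof.
move=> e0 n0; set D := [set x | _].
have nR : 0 < n%:R :> R by rewrite ltr0n.
have mD : measurable D by exact: deviation_event_measurable.
have c0 : 0 < (e * n%:R) ^+ 2 by rewrite exprn_gt0// mulr_gt0.
have : (((e * n%:R) ^+ 2)%:E * P D <= (2 * L * n)%:R%:E)%E.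
  apply: le_trans (integral_deviation_sqr n).
  have -> : P D = (\int[P]_x (\1_D x)%:E)%E by rewrite integral_indic ?setIT.
  have mi : measurable_fun setT (fun x => (\1_D x : R)%:E).
    by apply/measurable_EFinP; exact: measurable_indic.
  have i0 x : [set: T] x -> (0 <= (\1_D x : R)%:E)%E by rewrite lee_fin indicE.
  have c0' : (0 <= ((e * n%:R) ^+ 2)%:E)%E by rewrite lee_fin ltW.
  rewrite -ge0_integralZl//.
  apply: ge0_le_integral => //.
  - by move=> x _; rewrite mule_ge0// lee_fin ?ltW// indicE.
  - by apply: measurable_funeM; apply/measurable_EFinP; exact: measurable_indic.
  - by apply/measurable_EFinP/measurable_funX; exact: measurable_deviation.
  - move=> x _; rewrite -EFinM lee_fin indicE.
    case: (boolP (x \in D)); last by rewrite mulr0 sqr_ge0.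
    rewrite inE/= => xD; rewrite mulr1 -[leRHS]real_normK ?num_real//.
    by rewrite ler_sqr ?nnegrE ?mulr_ge0// ltW.
have fD : P D \is a fin_num by exact: fin_num_measure.
rewrite -(fineK fD) -EFinM !lee_fin => h.
rewrite ler_pdivlMr// ler_pdivlMr ?exprn_gt0//.
have -> : fine (P D) * n%:R * e ^+ 2 = ((e * n%:R) ^+ 2 * fine (P D)) / n%:R.
  by field; rewrite gt_eqF.
by rewrite ler_pdivrMr// -natrM.
Qed.

Lemma deviation_limsup0 (e : R) : 0 < e -> P (lim_sup_set (fun k =>
  [set x | e * (k.+1 * k.+1)%:R <= `|deviation (k.+1 * k.+1) x|])) = 0%E.
Proof.
move=> e0; apply: lim_sup_set_cvg0; first by move=> k; exact: deviation_event_measurable.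
pose C := (2 * L)%:R / e ^+ 2.
have C0 : 0 <= C by rewrite divr_ge0// exprn_ge0// ltW.
pose D (k : nat) :=
  [set x | e * (k.+1 * k.+1)%:R <= `|deviation (k.+1 * k.+1) x|].
(* Along the squares the Markov bound is [C / k.+1 ^ 2], dominated by a telescoping series of total
   at most [2 * C]. *)
have PD k : (P (D k) <= (2 * C / k.+1%:R - 2 * C / k.+2%:R)%:E)%E.
  apply: le_trans (deviation_markov e0 _) _; first by rewrite muln_gt0.
  have e1 : k.+1%:R = k%:R + 1 :> R by rewrite -natr1.
  have e2 : k.+2%:R = k%:R + 2 :> R by rewrite -addn2 natrD.
  rewrite lee_fin -/C natrM e1 e2.
  have k0 : 0 <= k%:R :> R by [].
  move: (k%:R : R) k0 => x x0.
  rewrite -subr_ge0.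
  have -> : 2 * C / (x + 1) - 2 * C / (x + 2) - C / ((x + 1) * (x + 1)) =
    C * (x / ((x + 1) ^+ 2 * (x + 2))).
    by field; apply/andP; split; rewrite gt_eqF//; lra.
  by rewrite mulr_ge0// divr_ge0// mulr_ge0 ?sqr_ge0//; lra.
apply: (@le_lt_trans _ _ (2 * C)%:E); last exact: ltry.
apply: lime_le; first by apply: is_cvg_nneseries => *; exact: measure_ge0.
apply: nearW => m.
apply: (@le_trans _ _ (\sum_(0 <= k < m) (2 * C / k.+1%:R - 2 * C / k.+2%:R)%:E)%E).
  by apply: lee_sum => k _; exact: PD.
rewrite sumEFin lee_fin.
have -> : \sum_(0 <= k < m) (2 * C / k.+1%:R - 2 * C / k.+2%:R) =
   2 * C - 2 * C / m.+1%:R.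
  elim: m => [|m IH]; first by rewrite big_nil divr1 subrr.
  by rewrite big_nat_recr//= IH addrA addrNK.
by rewrite gerBl divr_ge0// mulr_ge0.
Qed.

(* Chebyshev and Borel-Cantelli along the squares; the gaps between
   consecutive squares are negligible. *)
Lemma strong_law : {ae P, forall x, visits n x / n%:R @[n --> \oo] --> p}.
Proof.
pose D (l k : nat) := [set x | l.+1%:R^-1 * (k.+1 * k.+1)%:R <=
  `|deviation (k.+1 * k.+1) x|].
have mD l k : measurable (D l k) by exact: deviation_event_measurable.
have : P.-negligible (\bigcup_l lim_sup_set (D l)).
  apply: negligible_bigcup => l; apply/negligibleP.
    by apply: bigcap_measurable => // k _; exact: bigcup_measurable.
  by apply: deviation_limsup0; rewrite invr_gt0.
apply: negligibleS => x /= nx; apply: contrapT => xD; apply: nx.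
have [p0 p1] := andP p01.
pose b k := \1_(A k) x - p.
have Sb n : \sum_(k < n) b k = deviation n x.
  by rewrite /b big_split/= sumrN sumr_const card_ord /deviation mulr_natl.
have : (\sum_(i < n) b i) / n%:R @[n --> \oo] --> (0 : R).
  apply: cvg_mean_squares => [k|e e0].
    by rewrite /b indicE; case: (_ \in _); rewrite ler_norml/=; lra.
  have [l le] : exists l, l.+1%:R^-1 < e.
    have [l _ /(_ l (leqnn _)) le] := near_infty_natSinv_lt (PosNum e0).
    by exists l.
  apply: contrapT => nK; apply: xD; exists l => // K _ /=.
  apply: contrapT => nD; apply: nK; exists K => k Kk.
  rewrite Sb ltNge; apply/negP => h; apply: nD; exists k => //.
  by apply: le_trans h; rewrite ler_pM2r ?ltr0n ?muln_gt0// ltW.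
move=> /(cvgD (@cvg_cst _ p _ \oo _)); rewrite addr0.
apply: cvg_trans; apply: near_eq_cvg; near=> n.
have n0 : n%:R != 0 :> R by rewrite pnatr_eq0 -lt0n; near: n; exists 1%N.
rewrite -[LHS]/(p + (\sum_(i < n) b i) / n%:R) Sb /deviation.
by rewrite mulrBl mulrAC mulfV// mul1r addrC subrK.
Unshelve. all: by end_near. Qed.

End LawOfLargeNumbers.

(** * Birkhoff averages of integer-valued functions *)

Section IntPolyValues.
Variables (R : realType) (m : nat) (w : 'I_m -> R).
Local Notation Zw := (int_poly_values w).

Lemma ipv_int (k : int) : Zw k%:~R.
Proof. exact: (ex_intro2 _ _ _ I (mpoly.mmapC w intr k)). Qed.

Lemma ipv_var j : Zw (w j).
Proof.
apply: (ex_intro2 _ _ (mpoly.mpolyX int (mpoly.mnm1 j)) I).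
by rewrite mpoly.mmapX mpoly.mmap1U.
Qed.

Lemma ipvD a b : Zw a -> Zw b -> Zw (a + b).
Proof.
move=> [p _ <-] [q _ <-].
exact: (ex_intro2 _ _ _ I (mpoly.mmapD w intr p q)).
Qed.

Lemma ipvM a b : Zw a -> Zw b -> Zw (a * b).
Proof.
move=> [p _ <-] [q _ <-].
have [mM _] := mpoly.mmap_is_multiplicative w (intr : {rmorphism int -> R}).
exact: (ex_intro2 _ _ _ I (mM p q)).
Qed.

Lemma ipv_sum (I : Type) (r : seq I) (F : I -> R) :
  (forall i, Zw (F i)) -> Zw (\sum_(i <- r) F i).
Proof.
move=> h; elim: r => [|i r IH]; first by rewrite big_nil; exact: (ipv_int 0).
by rewrite big_cons; exact: ipvD.
Qed.

Lemma ipv_prod (I : Type) (r : seq I) (F : I -> R) :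
  (forall i, Zw (F i)) -> Zw (\prod_(i <- r) F i).
Proof.
move=> h; elim: r => [|i r IH]; first by rewrite big_nil; exact: (ipv_int 1).
by rewrite big_cons; exact: ipvM.
Qed.

(** Monomials are spelled as words of letters because a word can be read off directly as a
    cylinder. *)
Lemma ipv_words a : Zw a -> exists l : seq (int * seq 'I_m),
  a = \sum_(x <- l) x.1%:~R * \prod_(j <- x.2) w j.
Proof.
move=> [p _ <-]; rewrite /mpoly.mmap.
move: (mpoly.msupp p) => r; elim: r => [|e r [l IH]].
  by exists [::]; rewrite !big_nil.
have [u eu] : exists u, mpoly.mmap1 w e = \prod_(j <- u) w j.
  rewrite /mpoly.mmap1.
  elim: (index_enum _) => [|i s [u IHs]]; first by exists [::]; rewrite !big_nil.
  rewrite big_cons IHs.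
  move: (mpoly.fun_of_multinom e i) => k.
  exists (nseq k i ++ u).
  by rewrite big_cat/= big_nseq iter_mulr_1.
exists ((mpoly.mcoeff e p, u) :: l).
by rewrite !big_cons IH eu.
Qed.

End IntPolyValues.

(** * Birkhoff averages over a general system *)

Section Birkhoff.
Variables (R : realType) (S : system R) (mu : probability (borel S) R).
Implicit Types f g h : S -> R.

Definition birkhoff (f : S -> R) (a : R) :=
  {ae mu, forall w,
    (\sum_(k < N) f (iter k (@Defs.shift R S) w)) / N%:R @[N --> \oo] --> a}.

Lemma birkhoff0 : birkhoff (cst 0) 0.
Proof.
apply: aeW => w; apply: cvg_trans (@cvg_cst _ (0 : R) _ \oo _).
by apply: near_eq_cvg; near=> N; rewrite big1// mul0r.
Unshelve. all: by end_near. Qed.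

Lemma birkhoffD f g (a b : R) : birkhoff f a -> birkhoff g b ->
  birkhoff (fun w => f w + g w) (a + b).
Proof.
move=> fa gb; apply: (@filterS2 _ _ (ae_filter_ringOfSetsType mu) _ _ _ _ fa gb).
move=> w {}fa {}gb.
apply: cvg_trans (cvgD fa gb); apply: near_eq_cvg; near=> N.
by rewrite big_split/= mulrDl.
Unshelve. all: by end_near. Qed.

Lemma birkhoffZ (c : R) f (a : R) :
  birkhoff f a -> birkhoff (fun w => c * f w) (c * a).
Proof.
move=> fa; apply: (@filterS _ _ (ae_filter_ringOfSetsType mu) _ _ _ fa) => w {}fa.
apply: cvg_trans (cvgM (@cvg_cst _ c _ \oo _) fa); apply: near_eq_cvg; near=> N.
by rewrite -mulr_sumr -mulrA.
Unshelve. all: by end_near. Qed.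

Lemma birkhoff_sum (I : Type) (r : seq I) (f : I -> S -> R) (a : I -> R) :
  (forall i, birkhoff (f i) (a i)) ->
  birkhoff (fun w => \sum_(i <- r) f i w) (\sum_(i <- r) a i).
Proof.
move=> fa; elim: r => [|i r IH].
  by rewrite big_nil; under eq_fun do rewrite big_nil; exact: birkhoff0.
rewrite big_cons; under eq_fun do rewrite big_cons.
exact: birkhoffD.
Qed.


Lemma continuous_bounded (h : S -> R) : continuous h ->
  exists M, forall w, `|h w| <= M.
Proof.
move=> ch.
have [M [_ hM]] : bounded_set (h @` [set: S]).
  apply: compact_bounded; apply: continuous_compact; last exact: phase_compact.
  exact: continuous_subspaceT.
exists (M + 1) => w; apply: (hM (M + 1)); first by rewrite ltrDl.
by exists w.
Qed.

Lemma cvg_bounded_div (M : R) (u : nat -> R) : (forall k, `|u k| <= M) ->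
  u k / k%:R @[k --> \oo] --> (0 : R).
Proof.
move=> uM; have M0 : 0 <= M by apply: le_trans (uM 0%N).
apply/cvgrPdist_lt => e e0.
pose K := (Num.truncn (M / e)).+1.
exists K.+1 => // k /= Kk.
have k0 : 0 < k%:R :> R by rewrite ltr0n; apply: leq_trans Kk.
rewrite sub0r normrN normrM normfV (ger0_norm (ltW k0)) ltr_pdivrMr//.
apply: le_lt_trans (uM k) _; rewrite mulrC -ltr_pdivrMr//.
apply: lt_le_trans (truncnS_gt _) _; rewrite ler_nat.
by apply: leq_trans Kk; rewrite /K.
Qed.

(** The sums of the coboundary telescope to [h (T^N w) - h w], bounded because the phase space is
    compact. *)
Lemma birkhoff_coboundary f h (a : R) : continuous h -> birkhoff f a ->
  birkhoff (fun w => f w + (h (Defs.shift w) - h w)) a.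
Proof.
move=> ch fa; rewrite -[a]addr0; apply: birkhoffD => //.
have [M hM] := continuous_bounded ch.
apply: aeW => w.
have -> : (fun N => (\sum_(k < N) (h (Defs.shift (iter k (@Defs.shift R S) w)) -
    h (iter k (@Defs.shift R S) w))) / N%:R) =
  (fun N => (h (iter N (@Defs.shift R S) w) - h w) / N%:R).
  apply/funext => N; congr (_ / _).
  elim: N => [|N IH]; first by rewrite big_ord0 subrr.
  by rewrite big_ord_recr/= IH addrC addrA subrK.
apply: (@cvg_bounded_div (M + M)) => k.
by apply: le_trans (ler_normB _ _) _; rewrite lerD.
Qed.

End Birkhoff.

(** * Cylinders under the product measure *)

Section ProductMeasure.
Variables (R : realType) (n : nat).
Local Notation Omega := (full_shift R n).
Implicit Types (a u v w : Omega) (s : seq int).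

Definition cyl s a : set Omega := [set w | forall j, j \in s -> w j = a j].

Lemma iter_shift (k : nat) w (j : int) :
  iter k (@Defs.shift R Omega) w j = w (j + k%:Z).
Proof.
elim: k j => [|k IH] j; first by rewrite addr0.
rewrite /= /translate IH; congr (w _); lia.
Qed.

Lemma iter_unshift (k : nat) w (j : int) :
  iter k (@Defs.unshift R Omega) w j = w (j - k%:Z).
Proof.
elim: k j => [|k IH] j; first by rewrite subr0.
rewrite /= /translate IH; congr (w _); lia.
Qed.

Lemma window_bound s : exists N : nat, forall j, j \in s -> `|j| <= N%:Z.
Proof.
elim: s => [|i s [N sN]]; first by exists 0%N.
exists (`|i| + N)%N => j; rewrite inE => /orP[/eqP ->|/sN]; lia.
Qed.

Lemma open_cyl s a : open (cyl s a).
Proof.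
rewrite openE => w ws; have [N sN] := window_bound s.
apply: filterS (near_agree N w) => v wv j js.
by rewrite -wv ?sN// ws.
Qed.

Lemma measurable_cyl s a : measurable (cyl s a : set (borel Omega)).
Proof. by apply: sub_sigma_algebra; exact: open_cyl. Qed.

(** Pulling back translates the positions; the reference point moves along, so the prescribed
    letters, and hence the probability, stay the same. *)
Lemma iter_shift_cyl (k : nat) s a :
  [set w | cyl s a (iter k (@Defs.shift R Omega) w)] =
  cyl [seq j + k%:Z | j <- s] (iter k (@Defs.unshift R Omega) a).
Proof.
apply/seteqP; split=> w ws.
  by move=> _ /mapP[j js ->]; rewrite iter_unshift addrK -ws// iter_shift.
move=> j js; have jks : j + k%:Z \in [seq j + k%:Z | j <- s] by exact: map_f.
by rewrite [LHS]iter_shift (ws _ jks) [LHS]iter_unshift addrK.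
Qed.

Variables (mu0 : probability (borel (alphabet n)) R).
Variables (mu : probability (borel Omega) R).
Hypothesis pmu : is_product_measure mu0 mu.

Definition weight (j : 'I_n.+1) : R := fine (mu0 [set j]).

Lemma cyl_prob s a : uniq s -> mu (cyl s a) = (\prod_(j <- s) weight (a j))%:E.
Proof.
move=> us.
have := pmu [fset j in s]%fset (fun j => [set a j]).
have -> : [set w | forall j, j \in [fset j in s]%fset -> [set a j] (w j)] = cyl s a.
  apply/seteqP; split=> w /= h j.
    by move=> js; apply: h; rewrite in_fset.
  by rewrite in_fset; exact: h.
move=> ->; rewrite (perm_big s)/=; last first.
  by apply: uniq_perm; rewrite ?fset_uniq// => j; rewrite in_fset.
rewrite -prodEFin; apply: eq_bigr => j _.
rewrite /weight fineK//; apply: fin_num_measure.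
by apply: sub_sigma_algebra; exact: discrete_open.
Qed.

(** Disjoint position sets allow the two reference points to be merged into one, so the intersection
    is again a cylinder. *)
Lemma cyl_indep s a s' a' : uniq s -> uniq s' ->
  (forall j, j \in s -> j \notin s') ->
  mu (cyl s a `&` cyl s' a') =
  ((\prod_(j <- s) weight (a j)) * (\prod_(j <- s') weight (a' j)))%:E.
Proof.
move=> us us' ss'.
pose b : Omega := fun j => if j \in s then a j else a' j.
have -> : cyl s a `&` cyl s' a' = cyl (s ++ s') b.
  apply/seteqP; split=> w /=.
    move=> [h h'] j; rewrite mem_cat /b; case: ifP => /= [js _|_ js']; first exact: h.
    exact: h'.
  move=> h; split=> j js.
    by have := h j; rewrite mem_cat js /b js; apply.
  have := h j; rewrite mem_cat js orbT /b.
  by case: ifP => [/ss'|_]; [rewrite js|apply].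
rewrite cyl_prob; last first.
  rewrite cat_uniq us us' andbT; apply/hasPn => j js'.
  by apply/negP => /ss'; rewrite js'.
rewrite big_cat/=; congr (_ * _)%:E; apply: eq_big_seq => j js; rewrite /b ?js//.
by case: ifP => // /ss'; rewrite js.
Qed.

Lemma birkhoff_cyl s a : uniq s ->
  birkhoff mu (\1_(cyl s a)) (\prod_(j <- s) weight (a j)).
Proof.
move=> us; set p := \prod_(j <- s) _.
have [N sN] := window_bound s.
pose A k : set (borel Omega) := [set w | cyl s a (iter k (@Defs.shift R Omega) w)].
have mA k : measurable (A k) by rewrite /A iter_shift_cyl; exact: measurable_cyl.
have us' k : uniq [seq j + k%:Z | j <- s].
  by rewrite map_inj_uniq//; exact: addIr.
have pk k : \prod_(j <- [seq j + k%:Z | j <- s])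
    weight (iter k (@Defs.unshift R Omega) a j) = p.
  by rewrite big_map; apply: eq_bigr => j _; rewrite iter_unshift addrK.
have PA k : mu (A k) = p%:E by rewrite /A iter_shift_cyl cyl_prob// pk.
(* Positions lie in [[-N, N]], so translates by amounts at least [2 * N + 1] apart are disjoint. *)
have PAI j k : (j + (2 * N).+1 <= k)%N -> mu (A j `&` A k) = (p ^+ 2)%:E.
  move=> jk; rewrite /A !iter_shift_cyl cyl_indep// ?pk// => _ /mapP[x xs ->].
  by apply/negP => /mapP[y ys]; have := sN _ xs; have := sN _ ys; lia.
apply: filterS (strong_law mA PA PAI) => w.
apply: cvg_trans; apply: near_eq_cvg; near=> M.
congr (_ / _); apply: eq_bigr => k _.
Unshelve. all: by end_near. Qed.

Lemma birkhoff_int_valued (f : Omega -> R) : continuous f ->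
  (forall w, f w \is a Num.int) ->
  exists2 a, int_poly_values weight a & birkhoff mu f a.
Proof.
move=> cf If; have [N fN] := int_valued_window cf If.
pose s := [seq i%:Z - N%:Z | i <- iota 0 (2 * N).+1].
have us : uniq s by rewrite map_inj_uniq ?iota_uniq// => i j; lia.
have sE j : (j \in s) = (`|j| <= N%:Z).
  apply/mapP/idP => [[i]|jN]; first by rewrite mem_iota => ? ->; lia.
  exists `|(j + N%:Z)%R|%N; last by lia.
  by rewrite mem_iota; lia.
pose W := {ffun 'I_(2 * N).+1 -> 'I_n.+1}.
(* The word [u] is written on the window [[-N, N]]; the letters outside it are arbitrary. *)
pose ext (u : W) : Omega := fun j => u (inord `|(j + N%:Z)%R|%N).
exists (\sum_(u : W) f (ext u) * \prod_(j <- s) weight (ext u j)).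
  apply: ipv_sum => u; apply: ipvM; last by apply: ipv_prod => j; exact: ipv_var.
  by have /intrP[k ->] := If (ext u); exact: ipv_int.
suff fE : f = fun w => \sum_(u : W) f (ext u) * \1_(cyl s (ext u)) w.
  by rewrite [X in birkhoff mu X]fE; apply: birkhoff_sum => u;
    apply: birkhoffZ; exact: birkhoff_cyl.
apply/funext => w.
pose u0 : W := [ffun i : 'I_(2 * N).+1 => (w (i%:Z - N%:Z) : 'I_n.+1)].
have ext0 j : `|j| <= N%:Z -> ext u0 j = w j.
  move=> jN; rewrite /ext ffunE inordK; last by lia.
  by congr (w _); lia.
(* Exactly one word, the one read off [w], has a cylinder containing [w]. *)
rewrite (bigD1 u0)//= big1 ?addr0.
  rewrite indicE mem_set ?mulr1//; last by move=> j; rewrite sE => /ext0 ->.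
  by apply: fN => j jN; rewrite ext0.
move=> u uu0; rewrite indicE memNset ?mulr0// => h.
move/eqP: uu0; apply; apply/ffunP => i; rewrite ffunE.
rewrite h ?sE; last by have := ltn_ord i; lia.
rewrite /ext; congr (u _); apply: val_inj; rewrite /= inordK; have := ltn_ord i; lia.
Qed.

Lemma indic_cyl_continuous s a : continuous (\1_(cyl s a) : Omega -> R).
Proof.
move=> w A /= nA; have [N sN] := window_bound s.
apply: filterS (near_agree N w) => v wv; rewrite /preimage/=.
suff -> : \1_(cyl s a) v = \1_(cyl s a) w :> R by exact: nbhs_singleton.
rewrite !indicE; congr (nat_of_bool _)%:R; apply/idP/idP; rewrite !inE => h j js.
  by rewrite wv ?sN// h.
by rewrite -wv ?sN// h.
Qed.

Lemma int_poly_values_birkhoff (a : R) : int_poly_values weight a ->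
  exists f : Omega -> R,
    [/\ continuous f, forall w, f w \is a Num.int & birkhoff mu f a].
Proof.
move=> /ipv_words[l ->].
(* Repeated letters of a word sit at distinct positions, so powers of a weight come from independent
   coordinates. *)
pose s (u : seq 'I_n.+1) := [seq i%:Z | i <- iota 0 (size u)].
pose b (u : seq 'I_n.+1) : Omega := fun j => nth ord0 u `|j|%N.
exists (fun w => \sum_(x <- l) x.1%:~R * \1_(cyl (s x.2) (b x.2)) w); split.
- move=> w; apply: continuous_sum_at => x.
  exact/continuousZ_at/indic_cyl_continuous.
- move=> w; apply: rpred_sum => x _; rewrite rpredM ?intr_int// indicE.
  by case: (w \in _); rewrite ?rpred0 ?rpred1.
- apply: birkhoff_sum => x; apply: birkhoffZ.
  rewrite (_ : \prod_(j <- x.2) weight j = \prod_(j <- s x.2) weight (b x.2 j)).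
    by apply: birkhoff_cyl; rewrite map_inj_uniq ?iota_uniq// => i j [].
  rewrite big_map (big_nth ord0) /index_iota subn0; apply: eq_bigr => i _.
  by rewrite /b.
Qed.

End ProductMeasure.

(** * Rotation numbers on the suspension *)

Lemma continuous_int_const (R : realType) (d : R -> R) : continuous d ->
  (forall r, d r \is a Num.int) -> forall a b, d a = d b.
Proof.
move=> cd Id a b.
have := @continuous_int_eq R (fun r => d (a + r * (b - a))).
have e : a + (b - a) = b by ring.
rewrite mul0r addr0 mul1r e; apply => // r _.
apply: (@continuous_comp _ _ _ (fun r : R => a + r * (b - a)) d); last exact: cd.
apply: continuousD_at; first exact: cvg_cst.
by apply: continuousM_at; [exact: cvg_id|exact: cvg_cst].
Qed.

Section Suspension.
Variables (R : realType) (S : system R).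
Implicit Types (w v : S) (x : suspension S) (phi : suspension S -> circle R).
Local Notation T := (@Defs.shift R S).

Lemma susp_iterz (k : int) w t : susp (iterz k w) t = susp w (t + k%:~R).
Proof.
apply/eqmodP/susp_rev/asboolP; exists k => /=.
by rewrite addrK.
Qed.

Lemma susp_continuous : continuous (fun p : S * R => susp p.1 p.2).
Proof.
have -> : (fun p : S * R => susp p.1 p.2) = \pi_(suspension S).
  by apply/funext => -[].
exact: pi_continuous.
Qed.

Lemma continuous_on_susp (Z : topologicalType) (f : suspension S -> Z) :
  continuous (fun p : S * R => f (susp p.1 p.2)) -> continuous f.
Proof.
move=> /continuousP c; apply/continuousP => A /c.
by congr open; apply/seteqP; split=> -[].
Qed.

Lemma susp_repr x : susp (repr x).1 (repr x).2 = x.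
Proof. by rewrite /susp -surjective_pairing reprK. Qed.

Lemma iterz_continuous (k : int) : continuous (@iterz R S k).
Proof.
case: k => k; elim: k => [|k IH] w.
- exact: cvg_id.
- apply: (@continuous_comp _ _ _ (@iterz R S k) T); first exact: IH.
  exact: shift_continuous.
- exact: unshift_continuous.
- apply: (@continuous_comp _ _ _ (@iterz R S (Negz k)) (@unshift R S)).
    exact: IH.
  exact: unshift_continuous.
Qed.

Definition lifts (F : S * R -> R) phi :=
  continuous F /\ forall w t, to_circle (F (w, t)) = phi (susp w t).

Section Lift.
Variables (F : S * R -> R) (phi : suspension S -> circle R).
Hypothesis Fphi : lifts F phi.

Lemma lift_continuous_time w : continuous (fun t => F (w, t)).
Proof.
move=> t; apply: (@continuous_comp _ _ _ (fun t : R => (w, t)) F); last exact: Fphi.1.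
by apply: continuous_pair_at; [exact: cvg_cst|exact: cvg_id].
Qed.

(** Since [[T^k w, s] = [w, s + k]], both terms lift the same point; their difference is an integer
    depending continuously on time, hence constant in time. *)
Lemma lift_translate (k : int) w s t :
  F (w, s + k%:~R) - F (iterz k w, s) = F (w, t + k%:~R) - F (iterz k w, t).
Proof.
apply: (@continuous_int_const _ (fun s => F (w, s + k%:~R) - F (iterz k w, s))).
  move=> u; apply: continuousB_at; last exact: lift_continuous_time.
  apply: (@continuous_comp _ _ _ (fun u : R => u + k%:~R) (fun t => F (w, t))).
    by apply: continuousD_at; [exact: cvg_id|exact: cvg_cst].
  exact: lift_continuous_time.
by move=> u; apply/eq_to_circle; rewrite !Fphi.2 susp_iterz.
Qed.

(** The increment over [[i, i + 1]] along [w] equals the one over [[0, 1]] along [T^i w], by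
    [lift_translate]. *)
Lemma lift_increments w (N : nat) : F (w, N%:R) - F (w, 0) =
  \sum_(i < N) (F (iter i T w, 1) - F (iter i T w, 0)).
Proof.
elim: N => [|N IH]; first by rewrite big_ord0 subrr.
rewrite big_ord_recr/= -IH.
have := lift_translate N%:Z w 1 0.
rewrite add0r -[(Posz N)%:~R]/(N%:R) [1 + _]addrC natr1 /= => e.
lra.
Qed.

Lemma lift_bounded (a b : R) :
  exists M, forall w t, a <= t <= b -> `|F (w, t)| <= M.
Proof.
have [M [_ hM]] : bounded_set (F @` ([set: S] `*` `[a, b])).
  apply: compact_bounded; apply: continuous_compact.
    by apply: continuous_subspaceT; exact: Fphi.1.
  by apply: compact_setX; [exact: phase_compact|exact: segment_compact].
exists (M + 1) => w t tab; apply: (hM (M + 1)); first by rewrite ltrDl.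
by exists (w, t) => //; split => //=; rewrite in_itv.
Qed.

(* The lift F itself does not descend to the suspension, but its increments
   do; this makes the set of points with a given rotation number Borel. *)
Definition displacement (k : nat) x : R :=
  F ((repr x).1, (repr x).2 + k%:R) - F (repr x).

Lemma displacementE k w s : displacement k (susp w s) = F (w, s + k%:R) - F (w, s).
Proof.
rewrite /displacement /susp; case: piP => -[v r] /eqmodP /asboolP[n /= [-> ->]] /=.
have := lift_translate n w (s - n%:~R + k%:R) (s - n%:~R).
by rewrite addrAC !subrK => h; lra.
Qed.

Lemma displacement_continuous k : continuous (displacement k).
Proof.
apply: continuous_on_susp.
have -> : (fun p : S * R => displacement k (susp p.1 p.2)) =
    (fun p : S * R => F (p.1, p.2 + k%:R) - F p).
  by apply/funext => -[w s]; rewrite /= -displacementE.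
move=> p; apply: continuousB_at; last exact: Fphi.1.
apply: (@continuous_comp _ _ _ (fun p : S * R => (p.1, p.2 + k%:R)) F); last exact: Fphi.1.
apply: continuous_pair_at; first exact: cvg_fst.
by apply: continuousD_at; [exact: cvg_snd|exact: cvg_cst].
Qed.

(** From integer to real times: the increment over the fractional part of [t] is computed at [T^k w]
    on [[s, s + 1]], where [F] is bounded uniformly in the base point. *)
Lemma lift_rotation w s (a : R) :
  displacement k (susp w s) / k%:R @[k --> \oo] --> a ->
  F (w, s + t) / t @[t --> +oo] --> a.
Proof.
move=> ca.
have [M hM] := lift_bounded s (s + 1).
have M0 : 0 <= M by apply: le_trans (hM w s _); rewrite // lexx lerDl ler01.
apply/cvgrPdist_lt => e e0.
have e20 : 0 < e / 2 by rewrite divr_gt0.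
have /cvgrPdist_lt/(_ _ e20)[K _ hK] := ca.
(* Bounds the error terms: three values of [F], and [a] times a fractional part. *)
pose C := 3 * M + `|a|.
have C0 : 0 <= C by rewrite addr_ge0 ?mulr_ge0.
near=> t.
have t0 : 0 < t by near: t; exact: nbhs_pinfty_gt.
have tK : K.+1%:R < t by near: t; exact: nbhs_pinfty_gt.
have tC : 2 * C / e < t by near: t; apply: nbhs_pinfty_gt; exact: num_real.
pose k := Num.truncn t.
have /andP[k1 k2] : k%:R <= t < k.+1%:R by exact: truncn_itv (ltW t0).
have Kk : (K < k)%N.
  by rewrite -ltnS -(ltr_nat R); apply: lt_trans tK _.
have k0 : 0 < k%:R :> R by rewrite ltr0n; apply: leq_ltn_trans Kk.
have h1 := hK k (ltnW Kk).
rewrite /= displacementE in h1.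
have h2 : `|a * k%:R - (F (w, s + k%:R) - F (w, s))| < e / 2 * k%:R.
  rewrite -[X in `|_ - X|](divfK (lt0r_neq0 k0)) -mulrBl normrM.
  by rewrite (ger0_norm (ltW k0)) ltr_pM2r.
have h3 := lift_translate k%:Z w (s + (t - k%:R)) s.
have h3' : F (w, s + t) - F (w, s + k%:R) =
   F (iterz k w, s + (t - k%:R)) - F (iterz k w, s).
  move: h3; rewrite -[(Posz k)%:~R]/(k%:R) -addrA subrK => h3; lra.
have tk : 0 <= t - k%:R <= 1.
  by rewrite subr_ge0 k1/= lerBlDr addrC natr1 ltW.
have b1 : `|F (iterz k w, s + (t - k%:R))| <= M by apply: hM; lra.
have b2 : `|F (iterz k w, s)| <= M by apply: hM; lra.
have b3 : `|F (w, s)| <= M by apply: hM; lra.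
have -> : a - F (w, s + t) / t = (a * t - F (w, s + t)) / t.
  by rewrite mulrBl mulfK// gt_eqF.
rewrite normrM normfV (ger0_norm (ltW t0)) ltr_pdivrMr//.
have -> : a * t - F (w, s + t) = (a * k%:R - (F (w, s + k%:R) - F (w, s)))
    + a * (t - k%:R) - F (iterz k w, s + (t - k%:R)) + F (iterz k w, s) - F (w, s).
  by rewrite -[F (w, s + t)](subrK (F (w, s + k%:R))) h3'; ring.
have b4 : `|a * (t - k%:R)| <= `|a|.
  by rewrite normrM ler_piMr// ger0_norm; lra.
have h4 : e / 2 * k%:R <= e / 2 * t by rewrite ler_pM2l.
have h5 : C < e / 2 * t.
  by move: tC; rewrite ltr_pdivrMr// => tC; lra.
apply: le_lt_trans (ler_normB _ _) _.
apply: le_lt_trans (lerD (ler_normD _ _) (lexx _)) _.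
apply: le_lt_trans (lerD (lerD (ler_normB _ _) (lexx _)) (lexx _)) _.
apply: le_lt_trans (lerD (lerD (lerD (ler_normD _ _) (lexx _)) (lexx _)) (lexx _)) _.
rewrite /C in h5.
lra.
Unshelve. all: by end_near. Qed.

End Lift.
End Suspension.

Section RotationNumbers.
Variables (R : realType) (S : system R) (mu : probability (borel S) R).
Implicit Types (phi : suspension S -> circle R) (a b : R).
Local Notation T := (@Defs.shift R S).

(** The suspension measure integrates the fibre measures over the height, so the integrand vanishes
    identically. *)
Lemma suspension_negligible (A : set (suspension S)) :
  measurable (A : set (borel (suspension S))) ->
  (forall s, mu.-negligible [set w | A (susp w s)]) ->
  (suspension_measure mu).-negligible A.
Proof.
move=> mA nA; exists A; split => //.
apply: integral0_eq => s _; apply: measure_negligible; last exact: nA.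
have ms : measurable_fun setT ((fun w => susp w s) : borel S -> borel (suspension S)).
  apply: (@measurability _ _ (borel S) (borel (suspension S)) _ _
    (@open (suspension S))) => // _ [U oU <-].
  rewrite setTI; apply: sub_sigma_algebra.
  have c : continuous (fun w : S => susp w s).
    move=> w; apply: (@continuous_comp _ _ _ (fun w : S => (w, s)) (fun p => susp p.1 p.2)).
      by apply: continuous_pair_at; [exact: cvg_id|exact: cvg_cst].
    exact: susp_continuous.
  by move/continuousP : c; apply.
by rewrite -[X in measurable X]setTI; exact: ms.
Qed.

(** On the fibre at height [s], displacements over integer times differ from Birkhoff sums on the
    base by a bounded term, so the quotients converge for almost every base point. Borel
    measurability of the convergence set [G] then passes this to the suspension. *)
Lemma rotation_of_birkhoff (F : S * R -> R) phi a : lifts F phi ->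
  birkhoff mu (fun w => F (w, 1) - F (w, 0)) a -> has_rotation_number mu phi a.
Proof.
move=> Fphi bF.
pose B (l k : nat) : set (suspension S) :=
  [set x | `|a - displacement F k x / k%:R| < l.+1%:R^-1].
have oB l k : open (B l k).
  have cd : continuous (fun x => displacement F k x / k%:R).
    move=> x; apply: (@continuousM_at R (suspension S) (displacement F k)
      (fun=> k%:R^-1)); last exact: cst_continuous.
    exact: (displacement_continuous Fphi).
  have /continuousP/(_ (ball a l.+1%:R^-1)) := cd; apply.
  by apply: ball_open; rewrite invr_gt0.
pose G : set (suspension S) :=
  \bigcap_l \bigcup_K \bigcap_(k in [set k | (K <= k)%N]) B l k.
have GP x : G x <-> displacement F k x / k%:R @[k --> \oo] --> a.
  split=> [Gx|/cvgrPdist_lt ca].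
    apply/cvgrPdist_lt => e e0.
    have [l _ /(_ l (leqnn _)) /= le] := near_infty_natSinv_lt (PosNum e0).
    have [K _ KB] := Gx l I.
    by exists K => // k /= /KB; rewrite /B/= => h; apply: lt_trans le.
  move=> l _; have l0 : 0 < l.+1%:R^-1 :> R by rewrite invr_gt0.
  have [K _ hK] := ca _ l0.
  by exists K => // k /= /hK.
have mG : measurable (G : set (borel (suspension S))).
  apply: bigcap_measurable => // l _; apply: bigcupT_measurable => K.
  apply: bigcap_measurable => [|k _]; first by exists K => /=.
  by apply: sub_sigma_algebra; exact: oB.
have : (suspension_measure mu).-negligible (~` G).
  apply: suspension_negligible => [|s]; first exact: measurableC.
  apply: negligibleS bF => w /= nG h; apply: nG; apply/GP.
  have [M hM] := lift_bounded Fphi (- `|s|) `|s|.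
  rewrite -[a]addr0.
  (* Raising the start from height 0 to [s] changes the displacement by four values of [F] at
     heights in a bounded interval. *)
  have -> : (fun k => displacement F k (susp w s) / k%:R) = (fun k : nat =>
     (\sum_(i < k) (F (iter i T w, 1) - F (iter i T w, 0))) / k%:R +
     (F (iter k T w, s) - F (iter k T w, 0) - (F (w, s) - F (w, 0))) / k%:R).
    apply/funext => k; rewrite -mulrDl; congr (_ / _).
    rewrite -(lift_increments Fphi) (displacementE Fphi).
    have := lift_translate Fphi k%:Z w s 0.
    by rewrite -[(Posz k)%:~R]/(k%:R) add0r /= => e; lra.
  apply: cvgD; first exact: h.
  apply: (@cvg_bounded_div _ ((M + M) + (M + M))) => k.
  have s0 := normr_ge0 s.
  have hs v : `|F (v, s)| <= M by apply: hM; rewrite -ler_norml.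
  have h0 v : `|F (v, 0)| <= M by apply: hM; rewrite oppr_le0 s0.
  apply: le_trans (ler_normB _ _) _; apply: lerD.
    by apply: le_trans (ler_normB _ _) _; apply: lerD.
  by apply: le_trans (ler_normB _ _) _; apply: lerD.
apply: negligibleS => x /= nx Gx; apply: nx.
exists (fun t => F ((repr x).1, (repr x).2 + t)).
  split=> [t|t].
    apply: (@continuous_comp _ _ _ (fun t : R => (repr x).2 + t)
      (fun t => F ((repr x).1, t))).
      by apply: continuousD_at; [exact: cvg_cst|exact: cvg_id].
    exact: (lift_continuous_time Fphi).
  by rewrite Fphi.2 -susp_flowE susp_repr.
by apply: (lift_rotation Fphi); rewrite susp_repr; exact/GP.
Qed.

(** The measure has positive mass, so some point satisfies both almost-everywhere statements; two
    lifts along its orbit differ by a constant, which disappears after division by [t]. *)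
Lemma rotation_number_unique phi a b :
  has_rotation_number mu phi a -> has_rotation_number mu phi b -> a = b.
Proof.
move=> ra rb.
have pT : (0 < suspension_measure mu [set: suspension S])%E.
  by rewrite [suspension_measure mu _]probability_setT.
have FF := ae_properfilter_algebraOfSetsType pT.
have [x [[f [cf hf] fa] [g [cg hg] gb]]] :=
  @filter_ex _ _ FF _ (@filterI _ _ FF _ _ ra rb).
have cst_fg t : f t - g t = f 0 - g 0.
  apply: (@continuous_int_const _ (fun t => f t - g t)).
    by move=> u; apply: continuousB_at; [exact: cf|exact: cg].
  by move=> u; apply/eq_to_circle; rewrite hf hg.
apply/eqP; rewrite -subr_eq0; apply/eqP.
have h1 : f t / t - g t / t @[t --> +oo] --> a - b by exact: cvgB.
have h2 : f t / t - g t / t @[t --> +oo] --> (0 : R).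
  have -> : (fun t => f t / t - g t / t) = (fun t => (f 0 - g 0) * t^-1).
    by apply/funext => t; rewrite -mulrBl cst_fg.
  rewrite -[X in _ --> X](mulr0 (f 0 - g 0)); apply: cvgM; first exact: cvg_cst.
  apply: (iffRL (@gtr0_cvgV0 _ _ (nbhs +oo%R) _ id _)); last exact: cvg_id.
  exact: nbhs_pinfty_gt.
have <- := cvg_lim (@Rhausdorff R) h1.
exact: (cvg_lim (@Rhausdorff R) h2).
Qed.

(** The hypothesis makes the set inside [get] inhabited, so [get] returns a member of it; any member
    is a rotation number of [phi] itself, hence [a]. *)
Lemma schwartzmanE phi a : continuous phi ->
  (forall psi, homotopy_class R phi psi -> has_rotation_number mu psi a) ->
  schwartzman mu (homotopy_class R phi) = a.
Proof.
move=> cphi ra; rewrite /schwartzman.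
have phiphi : homotopy_class R phi phi.
  split => //; exists (fun p => phi p.1); split => //.
  apply: continuous_subspaceT => p.
  by apply: (@continuous_comp _ _ _ fst phi); [exact: cvg_fst|exact: cphi].
set A := [set b | _].
have : A (get A) by apply: (@getI _ A a).
by move=> /(_ _ phiphi) /rotation_number_unique; apply; exact: ra.
Qed.

End RotationNumbers.

(** * The Schwartzman group of the full shift *)

Section Clamp.
Variable R : realType.

(** Projection of the line onto [[0, 1]], written with absolute values to make continuity immediate.
    It extends homotopies to all real parameters and serves as a ramp. *)
Definition clamp (s : R) : R := (1 + `|s| - `|s - 1|) / 2.

Lemma clamp_continuous : continuous clamp.
Proof.
move=> s; rewrite /clamp.
have cn (c : R) : {for s, continuous (fun u : R => `|u - c|)}.
  apply: (@continuous_comp _ _ _ (fun u : R => u - c) Num.norm); last exact: norm_continuous.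
  by apply: continuousB_at; [exact: cvg_id|exact: cst_continuous].
apply: (@continuousM_at R R (fun s => 1 + `|s| - `|s - 1|) (fun=> 2^-1)).
  apply: continuousB_at; last exact: cn.
  by apply: continuousD_at; [exact: cst_continuous|exact: norm_continuous].
exact: cst_continuous.
Qed.

Lemma clamp_le0 s : s <= 0 -> clamp s = 0.
Proof.
by move=> s0; rewrite /clamp ler0_norm// ler0_norm; [field|lra].
Qed.

Lemma clamp_id s : 0 <= s <= 1 -> clamp s = s.
Proof.
by case/andP=> s0 s1; rewrite /clamp ger0_norm// ler0_norm; [field|lra].
Qed.

Lemma clamp_ge1 s : 1 <= s -> clamp s = 1.
Proof.
by move=> s1; rewrite /clamp ger0_norm ?ger0_norm; [field|lra|lra].
Qed.

Lemma clamp_itv s : 0 <= clamp s <= 1.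
Proof.
have [s0|s0] := leP s 0; first by rewrite clamp_le0// lexx ler01.
have [s1|s1] := leP s 1; first by rewrite clamp_id ?(ltW s0).
by rewrite clamp_ge1 ?lexx ?ler01// ltW.
Qed.

End Clamp.

(** * Homotopy invariance and realization *)

Section FullShiftRotation.
Variables (R : realType) (n : nat).
Local Notation Omega := (full_shift R n).
Local Notation T := (@Defs.shift R Omega).
Variables (mu0 : probability (borel (alphabet n)) R).
Variables (mu : probability (borel Omega) R).
Hypothesis pmu : is_product_measure mu0 mu.

Lemma homotopic_rotation (phi psi : suspension Omega -> circle R) :
  homotopic R phi psi ->
  exists2 a, int_poly_values (weight mu0) a &
    has_rotation_number mu phi a /\ has_rotation_number mu psi a.
Proof.
move=> [H [cH H0 H1]].
pose K (q : (Omega * R) * R) := (susp q.1.1 q.1.2, clamp q.2).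
pose G (q : (Omega * R) * R) := H (K q).
have cK : continuous K.
  move=> q; apply: (@continuous_pair_at _ _ _ (fun q : (Omega * R) * R =>
    susp q.1.1 q.1.2) (fun q : (Omega * R) * R => clamp q.2)).
    by apply: (@continuous_compT _ _ _ fst (fun p : Omega * R => susp p.1 p.2));
      [move=> ?; exact: cvg_fst|exact: susp_continuous].
  by apply: (@continuous_comp _ _ _ snd (@clamp R));
    [exact: cvg_snd|exact: clamp_continuous].
have KA q : ([set: suspension Omega] `*` `[0, 1]) (K q).
  by split => //=; rewrite in_itv/= clamp_itv.
(* [H] is continuous only within the strip; [K] takes values there, so the composite is continuous
   everywhere. *)
have cG : continuous G.
  move=> q U nU.
  have /subspace_continuousP/(_ _ (KA q) _ nU) HU := cH.
  have HK : nbhs q (K @^-1` [set p |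
      ([set: suspension Omega] `*` `[0, 1]) p -> U (H p)]) := cK q _ HU.
  apply: (@filterS _ _ (nbhs_filter q) _ _ _ HK) => p /=.
  by apply; exact: KA.
have cw : continuous (fun w : Omega => G ((w, 0), 0)).
  apply: (@continuous_compT _ _ _ (fun w : Omega => ((w, 0 : R), 0 : R)) G) => //.
  by apply: (@continuous_compT _ _ _ (fun w : Omega => (w, 0 : R)) (fun p => (p, 0 : R)));
    exact: pairl_continuous.
(* The lift is extended over the base, the flow time and the homotopy parameter in turn, each stage
   supplying the initial values of the next. *)
have [h0 ch0 h0E] := full_space_lift cw.
have cp : continuous (fun p : Omega * R => G (p, 0)).
  apply: (@continuous_compT _ _ _ (fun p : Omega * R => (p, 0 : R)) G) => //.
  exact: pairl_continuous.
have [F1 cF1 F1E] := lift_line cp ch0 h0E.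
have [F2 cF2 F2E] := lift_line cG cF1 F1E.
have cF2s s : continuous (fun p : Omega * R => F2 (p, s)).
  apply: (@continuous_compT _ _ _ (fun p : Omega * R => (p, s)) F2) => //.
  exact: pairl_continuous.
have cF2t t s : continuous (fun w : Omega => F2 ((w, t), s)).
  apply: (@continuous_compT _ _ _ (fun w : Omega => (w, t)) (fun p => F2 (p, s))) => //.
  exact: pairl_continuous.
have cF2r p : continuous (fun s => F2 (p, s)).
  apply: (@continuous_compT _ _ _ (fun s : R => (p, s)) F2) => //.
  exact: pairr_continuous.
pose f s (w : Omega) := F2 ((w, 1), s) - F2 ((T w, 0), s).
have If s w : f s w \is a Num.int.
  have e : susp w 1 = susp (T w) 0 by rewrite (susp_iterz 1 w) add0r.
  by apply/eq_to_circle; rewrite !F2E /G /K/= e.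
have f01 : f 0 = f 1.
  apply/funext => w; apply: (@continuous_int_const _ (fun s => f s w)) => // s.
  by apply: continuousB_at; exact: cF2r.
have cf s : continuous (f s).
  move=> w; apply: continuousB_at; first exact: cF2t.
  apply: (@continuous_comp _ _ _ T (fun w => F2 ((w, 0), s))); last exact: cF2t.
  exact: shift_continuous.
have [a Za fa] := birkhoff_int_valued pmu (cf 0) (If 0).
exists a => //.
have rot s chi : (forall x, H (x, clamp s) = chi x) -> birkhoff mu (f s) a ->
    has_rotation_number mu chi a.
  move=> Hs fsa; apply: (@rotation_of_birkhoff _ _ _ (fun p => F2 (p, s))).
    by split => // w t; rewrite F2E /G /K/= Hs.
  have -> : (fun w : Omega => F2 ((w, 1), s) - F2 ((w, 0), s)) =
    (fun w => f s w + (F2 ((T w, 0), s) - F2 ((w, 0), s))).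
    by apply/funext => w; rewrite /f addrA subrK.
  exact: (@birkhoff_coboundary _ _ _ _ (fun w => F2 ((w, 0), s))).
split; first by apply: (rot 0) => // x; rewrite clamp_le0.
by apply: (rot 1) => [x|]; [rewrite clamp_ge1|rewrite -f01].
Qed.

(** The value at any time forced by the identification. At integer times it jumps by a value of [f];
    for integer-valued [f] this is invisible in the circle. *)
Definition suspend (f : Omega -> R) (p : Omega * R) : R :=
  (p.2 - (Num.floor p.2)%:~R) * f (iterz (Num.floor p.2) p.1).

Lemma suspend_iterz f (k : int) w t :
  suspend f (iterz k w, t - k%:~R) = suspend f (w, t).
Proof.
rewrite /suspend/= floorDrz ?rpredN ?intr_int// -mulrNz intrKfloor.
rewrite mulrNz rmorphD /= mulrNz -iterzD subrK.
by congr (_ * _); ring.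
Qed.

Definition suspend_map (f : Omega -> R) (x : suspension Omega) : circle R :=
  to_circle (suspend f (repr x)).

Lemma suspend_mapE f w t : suspend_map f (susp w t) = to_circle (suspend f (w, t)).
Proof.
rewrite /suspend_map /susp; case: piP => q /eqmodP /asboolP[k ->] /=.
by rewrite suspend_iterz.
Qed.

Section Realization.
Variable f : Omega -> R.
Hypotheses (cf : continuous f) (If : forall w, f w \is a Num.int).

(* Near time k the map agrees modulo 1 with the sum of two ramps of heights
   f (T^(k-1) w) and f (T^k w), which is continuous across t = k. *)
Lemma suspend_ramps (k : int) w t : k%:~R - 1 < t < k%:~R + 1 ->
  to_circle (suspend f (w, t)) =
  to_circle (clamp (t + (1 - k%:~R)) * f (iterz (k - 1) w) +
             clamp (t - k%:~R) * f (iterz k w)).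
Proof.
move=> /andP[t1 t2]; apply/eq_to_circle; rewrite /suspend/=.
have [kt|tk] := leP k%:~R t.
  have -> : Num.floor t = k by apply: floor_def; rewrite kt intrD1.
  rewrite clamp_ge1 ?clamp_id; [|lra|lra].
  by rewrite mul1r opprD addrCA subrr addr0 rpredN.
have k1E : (k - 1)%:~R = k%:~R - 1 :> R by rewrite rmorphB.
have -> : Num.floor t = k - 1.
  by apply: floor_def; rewrite subrK tk k1E ltW.
rewrite k1E clamp_id; last lra.
rewrite (@clamp_le0 _ (t - k%:~R)); last lra.
rewrite mul0r addr0 opprB.
by rewrite subrr rpred0.
Qed.

Lemma suspend_map_continuous : continuous (suspend_map f).
Proof.
apply: continuous_on_susp => -[w t].
pose k := Num.floor t.
pose g (c : R) (j : int) (p : Omega * R) := clamp (p.2 + c) * f (iterz j p.1).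
have cg c j : continuous (g c j).
  move=> p; apply: (@continuousM_at R _ (fun p : Omega * R => clamp (p.2 + c))
    (fun p : Omega * R => f (iterz j p.1))).
    apply: (@continuous_comp _ _ _ (fun p : Omega * R => p.2 + c) (@clamp R)).
      by apply: continuousD_at; [exact: cvg_snd|exact: cst_continuous].
    exact: clamp_continuous.
  apply: (@continuous_comp _ _ _ (fun p : Omega * R => iterz j p.1) f); last exact: cf.
  by apply: (@continuous_comp _ _ _ fst (@iterz R Omega j));
    [exact: cvg_fst|exact: iterz_continuous].
pose h p := g (1 - k%:~R) (k - 1) p + g (- k%:~R) k p.
have E q : k%:~R - 1 < q.2 < k%:~R + 1 -> suspend_map f (susp q.1 q.2) = to_circle (h q).
  by move=> kq; rewrite suspend_mapE (suspend_ramps q.1 kq).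
have /andP[k1 k2] := floor_itv t.
rewrite intrD1 -/k in k2.
have kt : k%:~R - 1 < t < k%:~R + 1 by apply/andP; split; rewrite -/k in k1; lra.
have nE : \forall q \near (w, t), to_circle (h q) = suspend_map f (susp q.1 q.2).
  exists (setT, `]k%:~R - 1, k%:~R + 1[%classic) => /=.
    split; first exact: filterT.
    by apply: near_in_itvoo; rewrite in_itv.
  by move=> [v s] [_] /=; rewrite in_itv => /(E (v, s)).
rewrite /continuous_at E//.
apply: (cvg_trans (near_eq_cvg nE)).
apply: (@continuous_comp _ _ _ h (@to_circle R)).
  by apply: continuousD_at; exact: cg.
exact: to_circle_continuous.
Qed.

Lemma suspend_map_rotation a : birkhoff mu f a ->
  has_rotation_number mu (suspend_map f) a.
Proof.
move=> fa.
pose G (p : Omega * R) := suspend_map f (susp p.1 p.2).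
have cG : continuous G.
  by apply: continuous_compT; [exact: susp_continuous|exact: suspend_map_continuous].
have cw : continuous (fun w : Omega => G (w, 0)).
  apply: (@continuous_compT _ _ _ (fun w : Omega => (w, 0 : R)) G) => //.
  exact: pairl_continuous.
have [h0 ch0 h0E] := full_space_lift cw.
have [F cF FE] := lift_line cG ch0 h0E.
have Fphi : lifts F (suspend_map f) by split => // w t; rewrite FE.
apply: (rotation_of_birkhoff Fphi).
suff -> : (fun w => F (w, 1) - F (w, 0)) = f by [].
apply/funext => w.
(* No formula for [F] is needed: [F (w, r) - r * f w] is continuous and integer-valued on [[0, 1]],
   so its end values agree. *)
have := @continuous_int_eq R (fun r => F (w, r) - r * f w).
rewrite mul0r subr0 mul1r => ->; first by rewrite opprB addrC subrK.
  move=> r _; apply: continuousB_at; first exact: (lift_continuous_time Fphi).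
  by apply: (@continuousM_at R R id (fun=> f w)); [exact: cvg_id|exact: cst_continuous].
move=> r /andP[r0]; rewrite le_eqVlt => r1; apply/eq_to_circle.
rewrite FE /G suspend_mapE; apply/eq_to_circle; rewrite /suspend/=.
(* At [r = 1] the floor jumps and [suspend] is 0, congruent to [f w] because the latter is an
   integer. *)
case/orP: r1 => [/eqP ->|r1].
  by rewrite floor1 subrr mul0r sub0r mul1r rpredN.
have -> : Num.floor r = 0 by apply: floor_def; rewrite r0.
by rewrite subr0 subrr rpred0.
Qed.

End Realization.

Lemma schwartzman_group_full_shift :
  schwartzman_group mu = int_poly_values (weight mu0).
Proof.
apply/seteqP; split=> [_ [_ [phi cphi <-] <-]|a Za].
  (* The constant homotopy yields a rotation number of [phi]; every homotopic [psi] shares some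
     rotation number with [phi], and uniqueness identifies the two. *)
  have /homotopic_rotation[a Za [ra _]] : homotopic R phi phi.
    exists (fun p => phi p.1); split => //; apply: continuous_subspaceT => p.
    by apply: (@continuous_comp _ _ _ fst phi); [exact: cvg_fst|exact: cphi].
  rewrite (@schwartzmanE _ _ _ phi a)// => psi [_ /homotopic_rotation[b _ [rb rpsi]]].
  by rewrite (rotation_number_unique ra rb).
have [f [cf If fa]] := int_poly_values_birkhoff pmu Za.
have ra := suspend_map_rotation cf If fa.
exists (homotopy_class R (suspend_map f)).
  by exists (suspend_map f) => //; exact: suspend_map_continuous.
apply: schwartzmanE; first exact: suspend_map_continuous.
move=> psi [_ /homotopic_rotation[b _ [rb rpsi]]].
by rewrite (rotation_number_unique ra rb).
Qed.

End FullShiftRotation.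

(** When all variables take the value [c], each word evaluates to a power of [c]. This identifies
    the ring with [Z[c]], encoded as values of polynomials in one variable. *)
Lemma int_poly_values_cst (R : realType) (n : nat) (c : R) :
  int_poly_values (fun _ : 'I_n.+1 => c) = int_poly_values (fun _ : 'I_1 => c).
Proof.
by apply/seteqP; split=> _ /ipv_words[l ->]; apply: ipv_sum => x;
  (apply: ipvM; [exact: ipv_int|apply: ipv_prod => _]); exact: (ipv_var _ ord0).
Qed.

Theorem theorem7p9 (R : realType) (n : nat)
    (mu0 : probability (borel (alphabet n)) R)
    (mu : probability (borel (full_shift R n)) R) :
  is_product_measure mu0 mu ->
  let w (j : 'I_n.+1) : R := fine (mu0 [set j]) in
  schwartzman_group mu = int_poly_values w /\
  ((forall j, w j = n.+1%:R^-1) ->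
   schwartzman_group mu = int_poly_values (fun _ : 'I_1 => n.+1%:R^-1)).
Proof.
move=> pmu w; rewrite (schwartzman_group_full_shift pmu); split => // wE.
rewrite -(@int_poly_values_cst R n); congr int_poly_values.
by apply/funext => j; exact: wE.
Qed.
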